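(* Let $\phi:A^{\mathbb N}\to\mathbb R$ be a Hölder continuous potential and let $X\subset A^{\mathbb N}$ be a specified sofic subshift. Let $\mu^*\in\mathcal M_T(X)$ be the weak limit, as $m\to\infty$, of the Gibbs measures $\mu_\phi^m$ for $\phi$ on the finite type approximations $X_m$ of $X$. Then there exist a polynomial $Q_\mu$ of degree $2$ and $\theta_\mu\in(0,1)$ such that for all words $\mathbf a,\mathbf b\in\mathcal L^*(X)$ there exists $s^*=s^*(\mathbf a,\mathbf b)$ satisfying $$\left|\frac{\mu^*\left([\mathbf a]\cap T^{-s}[\mathbf b]\right)}{\mu^*[\mathbf a]\;\mu^*[\mathbf b]}-1\right|\le Q_\mu(\sqrt s)\,\theta_\mu^{\sqrt s}$$ for all integers $s\ge s^*$.
   Context: $A$ is a finite alphabet, $\mathbb N=\{1,2,\dots\}$, $\mathbb N_0=\mathbb N\cup\{0\}$. $A^{\mathbb N}$ is the set of one-sided sequences $\mathbf a=\mathbf a(0)\mathbf a(1)\mathbf a(2)\cdots$ with entries in $A$, with the product topology; $\mathbf a(m:n)$ denotes the word $\mathbf a(m)\mathbf a(m+1)\cdots\mathbf a(n)$. The shift $T$ is $(T\mathbf a)(i)=\mathbf a(i+1)$. A subshift is a nonempty compact $X\subset A^{\mathbb N}$ with $T(X)\subset X$. $\mathcal L_m(X)=\{\mathbf a(0:m):\mathbf a\in X\}$ is the set of $X$-admissible words of length $m+1$, and $\mathcal L^*(X)=\bigcup_{n\ge0}\mathcal L_n(X)$. For a word $\mathbf a$ of length $m+1$, $[\mathbf a]$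 is the cylinder of sequences $\mathbf b$ (in the subshift considered) with $\mathbf b(0:m)=\mathbf a$. A subshift of finite type is a set of the form $\{\mathbf a\in A^{\mathbb N}:\mathbf a(j:j+n)\in\mathcal L\ \forall j\in\mathbb N_0\}$ for some $n$ and some $\mathcal L\subset A^{n+1}$. A subshift is sofic if it is the image of a subshift of finite type (over a finite alphabet) under a continuous map commuting with the shifts. A subshift $X$ is specified, with specification length $\ell$, if for all $m,n\in\mathbb N_0$, all $\mathbf a\in\mathcal L_m(X)$, $\mathbf b\in\mathcal L_n(X)$ and all $k\ge\ell$ there is $\mathbf c\in X$ with $T^{m+n+2k+2}\mathbf c=\mathbf c$, $\mathbf c(0:m)=\mathbf a$ and $(T^{m+k+1}\mathbf c)(0:n)=\mathbf b$. The finite type approximation of order $m\in\mathbb N$ to $X$ is $X_m=\{\mathbf a\in A^{\mathbb N}:\mathbf a(j:j+m)\in\mathcal L_m(X)\ \forall j\in\mathbb N_0\}$. $\phi$ is Hölder continuous if there are $\theta\in[0,1)$ and $C>0$ with $\max\{|\phi(\mathbf a)-\phi(\mathbf b)|:\mathbf a(0:m)=\mathbf b(0:m)\}\le C\theta^m$ for all $m\ge0$. Put $S_k\phi=\sum_{i=0}^k\phi\circ T^i$. $\mathcal M_T(Y)$ is the set of $T$-invariant Borel probability measures on a subshift $Y$. A measure $\mu\in\mathcal M_T(Y)$ is a Gibbs measure for $\phi$ on $Y$ if there are constants $c>0$ and $P\in\mathbb R$ such that $c^{-1}\le\mu[\mathbf a(0:k)]/\exp(S_k\phi(\mathbf a)-(k+1)P)\le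 c$ for all $k\in\mathbb N_0$ and $\mathbf a\in Y$. It is a known fact that on each $X_m$ there is a unique Gibbs measure, denoted $\mu_\phi^m$. Measures on subshifts of $A^{\mathbb N}$ are regarded as measures on $A^{\mathbb N}$; under the present hypotheses the sequence $(\mu_\phi^m)_m$ converges weakly to a measure $\mu^*\in\mathcal M_T(X)$, which gives positive mass to every cylinder $[\mathbf a]$ with $\mathbf a\in\mathcal L^*(X)$. *)

(* Defs.v *)
From HB Require Import structures.
From mathcomp Require Import all_boot all_order all_algebra.
From mathcomp Require Import all_classical all_reals all_analysis.

Set Implicit Arguments.
Unset Strict Implicit.
Unset Printing Implicit Defensive.

Import Order.TTheory GRing.Theory Num.Theory.
Import numFieldNormedType.Exports.

Local Open Scope classical_set_scope.
Local Open Scope ring_scope.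

(* Nonempty finite alphabets: a measurableType has to be pointed. *)
#[short(type="pfinType")]
HB.structure Definition PointedFinite := {T of Finite T & Pointed T}.

Definition full_shift (A : finType) : Type :=
  prod_topology (fun _ : nat => discrete_topology A).

HB.instance Definition _ (A : finType) := Nbhs.on (full_shift A).
HB.instance Definition _ (A : finType) := Topological.on (full_shift A).
HB.instance Definition _ (A : pfinType) := Pointed.on (full_shift A).

Definition borel_shift (A : pfinType) : Type :=
  g_sigma_algebraType (@open (full_shift A)).

Section words.
Variable A : finType.
Implicit Types (a b c : full_shift A) (X : set (full_shift A)) (w : seq A).

Definition T_shift a : full_shift A := fun i => a i.+1.

(* The word a(m) a(m+1) ... a(n), both ends included. *)
Definition subword a (m n : nat) : seq A := [seq a i | i <- index_iota m n.+1].

Definition cylinder w : set (full_shift A) := [set b | mkseq b (size w) = w].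

(* The index is one less than the length: [lang X m] has words of length m+1. *)
Definition lang X (m : nat) : set (seq A) := [set subword a 0 m | a in X].

Definition lang_star X : set (seq A) := \bigcup_m lang X m.

Definition is_subshift X : Prop :=
  [/\ X !=set0, compact X & T_shift @` X `<=` X].

Definition is_sft X : Prop :=
  exists (n : nat) (L : set (seq A)),
    (forall w, L w -> size w = n.+1) /\
    X = [set a | forall j, L (subword a j (j + n))].

Definition is_specification_length X (l : nat) : Prop :=
  forall (m n : nat) (u v : seq A), lang X m u -> lang X n v ->
  forall k : nat, (l <= k)%N ->
  exists c, [/\ X c,
    iter (m + n + 2 * k + 2) T_shift c = c,
    subword c 0 m = u &
    subword (iter (m + k + 1) T_shift c) 0 n = v].

Definition is_specified X : Prop := exists l : nat, is_specification_length X l.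

Definition ft_approx X (m : nat) : set (full_shift A) :=
  [set a | forall j, lang X m (subword a j (j + m))].

End words.

(* The factor map is a total function of which only the restriction to the
   subshift of finite type Y matters. *)
Definition is_sofic (A : finType) (X : set (full_shift A)) : Prop :=
  exists (B : finType) (Y : set (full_shift B))
         (f : full_shift B -> full_shift A),
    [/\ is_sft Y, {within Y, continuous f},
        (forall y, Y y -> f (T_shift y) = T_shift (f y)) & f @` Y = X].

Section potentials.
Variables (R : realType) (A : finType).
Implicit Types phi : full_shift A -> R.

Definition is_holder phi : Prop :=
  exists theta C : R, [/\ 0 <= theta, theta < 1, 0 < C &
    forall (m : nat) (a b : full_shift A),
      subword a 0 m = subword b 0 m -> `|phi a - phi b| <= C * theta ^+ m].

Definition birkhoff_sum phi (k : nat) (a : full_shift A) : R :=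
  \sum_(0 <= i < k.+1) phi (iter i (@T_shift A) a).

End potentials.

Section measures.
Variables (R : realType) (A : pfinType).
Implicit Types (mu : probability (borel_shift A) R) (Y : set (full_shift A)).

(* mu belongs to M_T(Y), as a measure on the full shift carried by Y. *)
Definition invariant_on Y mu : Prop :=
  mu Y = 1%E /\
  forall E : set (borel_shift A), measurable E ->
    mu (@T_shift A @^-1` E) = mu E.

Definition is_gibbs (phi : full_shift A -> R) Y mu : Prop :=
  invariant_on Y mu /\
  exists c P : R, 0 < c /\
    forall (k : nat) (a : full_shift A), Y a ->
      c^-1 <= fine (mu (cylinder (subword a 0 k)))
              / expR (birkhoff_sum phi k a - k.+1%:R * P) <= c.

Definition weak_cvg (mu_ : nat -> probability (borel_shift A) R) mu : Prop :=
  forall f : full_shift A -> R, continuous f ->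
    (\int[mu_ n]_x (f x)%:E)%E @[n --> \oo] --> (\int[mu]_x (f x)%:E)%E.

End measures.

(* Main.v *)
(* Let [L] be the transfer operator of [phi] on [X], acting on all functions on
   [X].  For a synchronizing word [u] (it exists because [X] is sofic) the points
   [u y] have the same predecessors for all [y], so [L^n 1] and its localized
   versions are almost constant along points sharing a long prefix that
   contains [u]; specification makes every point reach [u] in boundedly many steps.
   A Doeblin argument then contracts the oscillation of [L^n F / L^n G]: each
   round costs [t + r] steps and has error [theta^t], hence [t] rounds give a
   decay [rho^t] after [t (t + r)] steps, i.e. the rate [rho^(sqrt s)].
   So the finite-volume measures of [phi] mix at this rate.  An invariant measure
   dominated by them coincides with their limit, by a variance estimate for
   frequencies of words.  On the approximations [X_m], which share the
   specification length of [X], this yields upper Gibbs bounds for [mu_m] that do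
   not depend on [m]; they pass to [mu], which is therefore the limit on [X]
   and mixes at the rate [rho^(sqrt s)]. *)
Require Import Defs.
From HB Require Import structures.
From mathcomp Require Import all_boot all_order all_algebra.
From mathcomp Require Import all_classical all_reals all_analysis.
From mathcomp Require Import zify ring lra.

Set Implicit Arguments.
Unset Strict Implicit.
Unset Printing Implicit Defensive.

Import Order.TTheory GRing.Theory Num.Theory.
Import numFieldNormedType.Exports.

Local Open Scope classical_set_scope.
Local Open Scope ring_scope.

(** The obstacle is that [X] need not be of finite type: which words may precede a point depends on
    the whole point, so [L] may destroy continuity. The usual cone of functions with Hölder
    logarithm is therefore replaced by [regular], which compares only points [v u y] and [v u y']
    with [u] synchronizing. The error [th ^+ J] coming from a common prefix [v] of length J is not
    reduced by later rounds; J has to grow with the number of rounds, and this is the source of the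
    square root. Neither an eigenfunction nor a conformal measure is constructed: all estimates
    concern ratios of iterates. On the approximation of order m the synchronizing word used has
    length m, so the contraction constant obtained there may degenerate as m grows. The Gibbs bound
    survives because it is read off in the limit, where only the distortion and Harnack constants
    remain, and these depend on the potential, the alphabet and [l] alone. The inclusion of [X] in
    its approximations carries upper bounds, not lower ones, over to [X]; positivity of the limit on
    cylinders is regained afterwards on [X] itself. *)

Section Rays.
Variable A : finType.
Implicit Types (c : A) (w : seq A) (x y : full_shift A).

Definition consr c x : full_shift A := fun i => if i is j.+1 then x j else c.

Definition catr w x : full_shift A := foldr consr x w.

Lemma catr_cat w1 w2 x : catr (w1 ++ w2) x = catr w1 (catr w2 x).
Proof. exact: foldr_cat. Qed.

Lemma T_consr c x : T_shift (consr c x) = x.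
Proof. by []. Qed.

Lemma consr_T x : consr (x 0%N) (T_shift x) = x.
Proof. by apply/funext; case. Qed.

Lemma iter_TE n x i : iter n (@T_shift A) x i = x (n + i)%N.
Proof. by elim: n i => // n IH i; rewrite iterS /T_shift IH addnS. Qed.

Lemma iter_T_catr w x : iter (size w) (@T_shift A) (catr w x) = x.
Proof. by elim: w => // c w IH; rewrite iterSr. Qed.

Lemma mkseq_cons x n : mkseq x n.+1 = x 0%N :: mkseq (T_shift x) n.
Proof.
rewrite /mkseq /= (iotaDl 1 0 n) -map_comp.
by congr (_ :: _); apply: eq_map.
Qed.

Lemma mkseq_catr w x n : mkseq (catr w x) (size w + n) = w ++ mkseq x n.
Proof. by elim: w => //= c w IH; rewrite mkseq_cons IH. Qed.

Lemma mkseq_catr0 w x : mkseq (catr w x) (size w) = w.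
Proof. by have := mkseq_catr w x 0; rewrite addn0 cats0. Qed.

Lemma mkseqD x n m :
  mkseq x (n + m) = mkseq x n ++ mkseq (iter n (@T_shift A) x) m.
Proof. by elim: n x => // n IH x; rewrite addSn !mkseq_cons IH iterSr. Qed.

Lemma catr_mkseq n x : catr (mkseq x n) (iter n (@T_shift A) x) = x.
Proof.
elim: n x => // n IH x; rewrite mkseq_cons iterSr /=.
by rewrite -/(catr _ _) IH consr_T.
Qed.

Lemma cylinderP w x : cylinder w x <-> exists y, x = catr w y.
Proof.
split=> [<-|[y ->]]; last exact: mkseq_catr0.
by exists (iter (size w) (@T_shift A) x); rewrite catr_mkseq.
Qed.

Lemma subwordE x j m : subword x j (j + m) = mkseq (iter j (@T_shift A) x) m.+1.
Proof.
rewrite /subword /index_iota /mkseq -addnS addKn.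
by rewrite -{1}[j]addn0 iotaDl -map_comp; apply: eq_map => i /=; rewrite iter_TE.
Qed.

Lemma subword0E x m : subword x 0 m = mkseq x m.+1.
Proof. exact: (subwordE x 0). Qed.

End Rays.

(** * Sums over words of a given length *)

Section TupleSums.
Variables (V : nmodType) (A : finType).
Implicit Types F : seq A -> V.

Lemma sumt0 F : \sum_(w : 0.-tuple A) F w = F [::].
Proof.
rewrite (eq_bigr (fun=> F [::])); last by move=> w _; rewrite tuple0.
by rewrite sumr_const card_tuple expn0.
Qed.

Lemma sumt_cons n F :
  \sum_(w : n.+1.-tuple A) F w = \sum_(c : A) \sum_(w : n.-tuple A) F (c :: w).
Proof.
rewrite pair_big /=.
rewrite (reindex (fun p : A * n.-tuple A => [tuple of p.1 :: p.2])) /=; first by [].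
exists (fun w : n.+1.-tuple A => (thead w, [tuple of behead w])) => [[c w]|w] _ /=.
  by congr (_, _); apply: val_inj.
by rewrite [w in RHS]tuple_eta.
Qed.

Lemma sumt_cat n m F :
  \sum_(w : (n + m).-tuple A) F w
  = \sum_(u : n.-tuple A) \sum_(v : m.-tuple A) F (u ++ v).
Proof.
elim: n F => [|n IH] F.
  by rewrite (sumt0 (fun u => \sum_(v : m.-tuple A) F (u ++ v))).
rewrite addSn sumt_cons (sumt_cons n (fun u => \sum_(v : m.-tuple A) F (u ++ v))).
by apply: eq_bigr => c _; rewrite (IH (fun w => F (c :: w))).
Qed.

Lemma sumt_pick a F :
  \sum_(w : (size a).-tuple A) (if a == w then F w else 0) = F a.
Proof.
rewrite -big_mkcond (big_pred1 (in_tuple a)) // => w.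
Qed.

End TupleSums.

Section SequenceLimits.
Variable R : realType.
Implicit Types (f : nat -> R) (b c : R).

Lemma cvg_le_cst f b c :
  f k @[k --> \oo] --> b -> (forall k, f k <= c) -> b <= c.
Proof. by move=> fb h; have := ler_cvg_to fb (cvg_cst c); apply; exact: nearW. Qed.

Lemma cvg_ge_cst f b c :
  f k @[k --> \oo] --> b -> (forall k, c <= f k) -> c <= b.
Proof. by move=> fb h; have := ler_cvg_to (cvg_cst c) fb; apply; exact: nearW. Qed.

End SequenceLimits.

(** * The transfer operator and its inverse branches *)

Section TransferOperator.
Variables (R : realType) (A : finType) (X : set (full_shift A)).
Variable phi : full_shift A -> R.
Implicit Types (F G H : full_shift A -> R) (w v : seq A) (x y : full_shift A).

Fixpoint wt w x : R :=
  if w is c :: v then expR (phi (catr w x)) * wt v x else 1.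

(** This is the iterate of order [size w] applied to [G] times the indicator of the cylinder of [w].
    The membership test lets all sums run over all tuples. *)
Definition opw w G x : R :=
  if `[< X (catr w x) >] then wt w x * G (catr w x) else 0.

Definition Lop n G x : R := \sum_(w : n.-tuple A) opw w G x.

Lemma wt_cat w1 w2 x : wt (w1 ++ w2) x = wt w1 (catr w2 x) * wt w2 x.
Proof.
elim: w1 => [|c w1 IH]; first by rewrite mul1r.
by rewrite /= IH mulrA -/(catr _ _) catr_cat.
Qed.

Lemma wt_gt0 w x : 0 < wt w x.
Proof. by elim: w => //= c w IH; rewrite mulr_gt0 ?expR_gt0. Qed.

Lemma opwT w G x : X (catr w x) -> opw w G x = wt w x * G (catr w x).
Proof. by move=> Xwx; rewrite /opw asboolT. Qed.

Lemma opwF w G x : ~ X (catr w x) -> opw w G x = 0.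
Proof. by move=> Xwx; rewrite /opw asboolF. Qed.

Lemma le_opw w F G x :
  (forall y, X y -> F y <= G y) -> opw w F x <= opw w G x.
Proof.
move=> FG; have [Xw|Xw] := pselect (X (catr w x)); last by rewrite !opwF.
by rewrite !opwT // ler_pM2l ?wt_gt0 // FG.
Qed.

Lemma le_Lop n F G x : (forall y, X y -> F y <= G y) -> Lop n F x <= Lop n G x.
Proof. by move=> FG; apply: ler_sum => w _; apply: le_opw. Qed.

Lemma opw_ge0 w F x : (forall y, X y -> 0 <= F y) -> 0 <= opw w F x.
Proof.
move=> F0; have [Xw|Xw] := pselect (X (catr w x)); last by rewrite !opwF.
by rewrite !opwT // mulr_ge0 ?F0 // ltW ?wt_gt0.
Qed.

Lemma Lop_ge0 n F x : (forall y, X y -> 0 <= F y) -> 0 <= Lop n F x.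
Proof. by move=> F0; apply: sumr_ge0 => w _; apply: opw_ge0. Qed.

Lemma opw_lin w a b F G x :
  opw w (fun y => a * F y + b * G y) x = a * opw w F x + b * opw w G x.
Proof.
have [Xw|Xw] := pselect (X (catr w x)); last by rewrite !opwF ?mulr0 ?addr0.
by rewrite !opwT //; ring.
Qed.

Lemma Lop_lin n a b F G x :
  Lop n (fun y => a * F y + b * G y) x = a * Lop n F x + b * Lop n G x.
Proof.
rewrite /Lop !mulr_sumr -big_split /=.
by apply: eq_bigr => w _; rewrite opw_lin.
Qed.

Lemma LopZ n a F x : Lop n (fun y => a * F y) x = a * Lop n F x.
Proof.
rewrite -[RHS]addr0 -(mul0r (Lop n F x)) -Lop_lin; congr Lop.
by apply/funext => y; rewrite mul0r addr0.
Qed.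

Lemma opw_sum (I : finType) w (F : I -> full_shift A -> R) x :
  opw w (fun y => \sum_i F i y) x = \sum_i opw w (F i) x.
Proof.
have [Xw|Xw] := pselect (X (catr w x)).
  by rewrite opwT // mulr_sumr; apply: eq_bigr => i _; rewrite opwT.
by rewrite opwF // big1 // => i _; rewrite opwF.
Qed.

Hypothesis X_shift : forall c x, X (consr c x) -> X x.

Lemma X_catr w x : X (catr w x) -> X x.
Proof. by elim: w => //= c w IH /X_shift. Qed.

Lemma opw_cat w1 w2 G : opw (w1 ++ w2) G = opw w2 (opw w1 G).
Proof.
apply/funext => x; have [Xw|Xw] := pselect (X (catr (w1 ++ w2) x)).
  rewrite opwT //; move: Xw; rewrite catr_cat => Xw.
  by rewrite opwT ?opwT ?wt_cat //; [ring|exact: X_catr Xw].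
rewrite opwF //; move: Xw; rewrite catr_cat => Xw.
have [Xw2|Xw2] := pselect (X (catr w2 x)); last by rewrite opwF.
by rewrite opwT // opwF // mulr0.
Qed.

Lemma LopD n m G : Lop (n + m) G = Lop m (Lop n G).
Proof.
apply/funext => x; rewrite /Lop (sumt_cat _ _ (fun w => opw w G x)) exchange_big /=.
by apply: eq_bigr => v _; rewrite opw_sum; apply: eq_bigr => w _; rewrite opw_cat.
Qed.

Lemma Lop_comm n m G : Lop n (Lop m G) = Lop m (Lop n G).
Proof. by rewrite -!LopD addnC. Qed.

Lemma opw_le_Lop w G x :
  (forall y, X y -> 0 <= G y) -> opw w G x <= Lop (size w) G x.
Proof.
move=> G0; rewrite /Lop (bigD1 (in_tuple w)) //= lerDl.
by apply: sumr_ge0 => v _; apply: opw_ge0.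
Qed.

(** * Bounded distortion of the weights *)

Variables (C th Phi : R).
Hypotheses (C_ge0 : 0 <= C) (th_ge0 : 0 <= th) (th_lt1 : th < 1).
Hypothesis phi_var : forall w x y, (0 < size w)%N ->
  `|phi (catr w x) - phi (catr w y)| <= C * th ^+ (size w).-1.
Hypothesis phi_sup : forall x, `|phi x| <= Phi.

Definition distortion : R := C / (1 - th).
Local Notation B := distortion.

(** The constant is the sum of the geometric series of variations; this fixed-point equation drives
    every induction that prepends a symbol. *)
Lemma distortionE : C + B * th = B.
Proof. by rewrite /B; field; apply/eqP => h; move: th_lt1; lra. Qed.

Lemma distortion_ge0 : 0 <= B.
Proof. by rewrite divr_ge0 // subr_ge0 ltW. Qed.

Lemma wt_distortion w x y : wt w x <= expR B * wt w y.
Proof.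
(* The partial sum of the geometric series is the bound that induction on [w] can carry. *)
suff: wt w x <= expR (B * (1 - th ^+ size w)) * wt w y.
  move=> /le_trans; apply; rewrite ler_pM2r ?wt_gt0 // ler_expR.
  by rewrite ler_piMr ?distortion_ge0 // gerBl exprn_ge0.
elim: w => [|c w IH]; first by rewrite /= expr0 subrr mulr0 expR0 mulr1.
have /= := @phi_var (c :: w) x y isT.
rewrite ler_norml => /andP[_ hphi].
have -> : B * (1 - th ^+ (size (c :: w)))
    = C * th ^+ size w + B * (1 - th ^+ size w).
  have -> : C = B - B * th by have := distortionE; lra.
  by rewrite /= exprS; ring.
rewrite /= expRD mulrACA; apply: ler_pM => //.
  exact/ltW/wt_gt0.
by rewrite -expRD ler_expR -lerBlDr.
Qed.

Lemma wt_lb w x : expR (- Phi) ^+ size w <= wt w x.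
Proof.
elim: w => [|c w IH] //=; rewrite exprS ler_pM ?exprn_ge0 ?expR_ge0 // ler_expR.
by have := phi_sup (catr (c :: w) x); rewrite ler_norml => /andP[].
Qed.

Lemma wt_ub w x : wt w x <= expR Phi ^+ size w.
Proof.
elim: w => [|c w IH] //=; rewrite exprS ler_pM ?expR_ge0 ?(ltW (wt_gt0 _ _)) //.
by rewrite ler_expR; apply: le_trans (ler_norm _) (phi_sup _).
Qed.

Local Notation one := (fun _ : full_shift A => @GRing.one R).

Lemma opw1E w x : X (catr w x) -> opw w one x = wt w x.
Proof. by move=> Xw; rewrite opwT // mulr1. Qed.

Lemma one_ge0 y : X y -> 0 <= one y. Proof. by []. Qed.

Definition Lop_bound : R := #|A|%:R * expR Phi.
Local Notation Lam := Lop_bound.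

Lemma Lop_bound_ge0 : 0 <= Lam.
Proof. by rewrite mulr_ge0 ?expR_ge0. Qed.

Lemma Lop1_ub n x : Lop n one x <= Lam ^+ n.
Proof.
rewrite exprMn -natrX -card_tuple -sumr_const mulr_suml /Lop.
apply: ler_sum => w _; rewrite mul1r.
have [Xw|Xw] := pselect (X (catr w x)); last by rewrite opwF // exprn_ge0 ?expR_ge0.
by rewrite opw1E // -{2}(size_tuple w) wt_ub.
Qed.

Lemma Lop_ub n G k x : (forall y, X y -> G y <= k) -> 0 <= k ->
  Lop n G x <= k * Lam ^+ n.
Proof.
move=> Gk k0; apply: (@le_trans _ _ (Lop n (fun y => k * one y) x)).
  by apply: le_Lop => y /Gk; rewrite mulr1.
by rewrite LopZ ler_wpM2l // Lop1_ub.
Qed.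

Lemma Lop_point w H x : (forall y, X y -> 0 <= H y) -> X (catr w x) ->
  expR (- Phi) ^+ size w * H (catr w x) <= Lop (size w) H x.
Proof.
move=> H0 Xw; apply: le_trans (opw_le_Lop w x H0).
by rewrite opwT // ler_wpM2r ?H0 // wt_lb.
Qed.

(** * Harnack inequality from specification *)

Variable l : nat.
Hypothesis X_spec : forall v x y, X (catr v y) -> X x ->
  exists2 w, size w = l & X (catr v (catr w x)).

(** The prefix of [x] of length n, linked to [x] by a connecting word, gives n + [l] letters in
    front of [x]; the last n of them are kept. *)
Lemma X_prev n x : X x -> exists2 w, size w = n & X (catr w x).
Proof.
move=> Xx; have Xp : X (catr (mkseq x n) (iter n (@T_shift A) x)).
  by rewrite catr_mkseq.
have [w sw] := X_spec Xp Xx; rewrite -catr_cat => Xw.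
exists (drop l (mkseq x n ++ w)); first by rewrite size_drop size_cat size_mkseq sw addnK.
by apply: (@X_catr (take l (mkseq x n ++ w))); rewrite -catr_cat cat_take_drop.
Qed.

Lemma Lop_gt0 n G x : (forall y, X y -> 0 < G y) -> X x -> 0 < Lop n G x.
Proof.
move=> G0 Xx; have [w <- Xw] := X_prev n Xx.
have := @Lop_point w G x (fun y Xy => ltW (G0 y Xy)) Xw.
by apply: lt_le_trans; rewrite mulr_gt0 ?exprn_gt0 ?expR_gt0 ?G0.
Qed.

Lemma Lop1_gt0 n x : X x -> 0 < Lop n one x.
Proof. exact: Lop_gt0. Qed.

Definition link_const : R := expR B * expR Phi ^+ l.

Lemma link_const_gt0 : 0 < link_const.
Proof. by rewrite mulr_gt0 ?exprn_gt0 ?expR_gt0. Qed.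

(** The continuation [y] of [w] is exchanged for a connecting word followed by [x]. Distortion pays
    for the exchange, and [expR Phi ^+ l] for the weight of the connecting word. *)
Lemma opw1_le_link w x y : X x -> X y ->
  opw w one y <= link_const * Lop l (opw w one) x.
Proof.
move=> Xx Xy.
have Lge0 : 0 <= Lop l (opw w one) x by apply: Lop_ge0 => z _; apply: opw_ge0.
have [Xw|Xw] := pselect (X (catr w y)); last first.
  by rewrite opwF // mulr_ge0 // ltW ?link_const_gt0.
have [v sv Xv] := X_spec Xw Xx.
rewrite opw1E // -mulrA.
apply: le_trans (wt_distortion w y (catr v x)) _.
rewrite ler_wpM2l ?expR_ge0 // -sv.
have := @Lop_point v (opw w one) x (fun z _ => opw_ge0 w z one_ge0) (X_catr Xv).
rewrite opw1E // sv => hP.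
have := ler_wpM2l (exprn_ge0 l (expR_ge0 Phi)) hP.
by rewrite mulrA -exprMn -expRD subrr expR0 expr1n mul1r.
Qed.

Definition harnack_const : R := link_const * Lam ^+ l.
Local Notation D := harnack_const.

(** Summing the linking estimate over [w] costs [l] extra steps at [x]. As iterates commute, these
    are moved inside, where they contribute at most [Lam ^+ l]. The constant involves neither n nor
    a synchronizing word. *)
Lemma harnack n x y : X x -> X y -> Lop n one y <= D * Lop n one x.
Proof.
move=> Xx Xy; apply: (@le_trans _ _ (link_const * Lop l (Lop n one) x)).
  rewrite /Lop -/(Lop l _ _).
  have -> : Lop l (fun z => \sum_(w : n.-tuple A) opw w one z) x
         = \sum_(w : n.-tuple A) Lop l (opw w one) x.
    rewrite /Lop exchange_big /=; apply: eq_bigr => v _; exact: opw_sum.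
  by rewrite mulr_sumr; apply: ler_sum => w _; apply: opw1_le_link.
rewrite /harnack_const -mulrA ler_wpM2l ?(ltW link_const_gt0) // Lop_comm.
apply: (@le_trans _ _ (Lop n (fun y => Lam ^+ l * one y) x)).
  by apply: le_Lop => z _; rewrite mulr1 Lop1_ub.
by rewrite LopZ.
Qed.

Lemma harnack_const_gt0 x : X x -> 0 < D.
Proof.
move=> Xx; have := harnack 0 Xx Xx; have := Lop1_gt0 0 Xx => L0.
by rewrite -{1}[Lop _ _ _]mul1r ler_pM2r // => /(lt_le_trans ltr01).
Qed.

(** * The synchronizing word and regular functions *)

Variables (u : seq A) (y0 : full_shift A).
Hypothesis X_u : X (catr u y0).
Hypothesis X_sync : forall p y y', X (catr u y) -> X (catr u y') ->
  X (catr p (catr u y)) -> X (catr p (catr u y')).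

(** Log-Hölder regularity, asked only of points whose common prefix ends in [u]: these have the same
    predecessors, which is what makes the property stable under the operator. *)
Definition regular F := forall v y y',
  X (catr v (catr u y)) -> X (catr v (catr u y')) ->
  F (catr v (catr u y)) <= expR (B * th ^+ size v) * F (catr v (catr u y')).

Definition nonneg F := forall y, X y -> 0 <= F y.

(** Prepending [c] lengthens the common prefix: [C * th ^+ size v] from the potential and
    [B * th ^+ (size v).+1] from [F] add up to [B * th ^+ size v]. *)
Lemma regular_opw1 c F : regular F -> nonneg F -> regular (opw [:: c] F).
Proof.
move=> rF F0 v y y' Xy Xy'.
have [Xc|Xc] := pselect (X (catr (c :: v) (catr u y))); last first.
  by rewrite [leLHS]opwF // mulr_ge0 ?expR_ge0 // opw_ge0.
have Xc' : X (catr (c :: v) (catr u y')).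
  exact: (X_sync (X_catr Xy) (X_catr Xy')).
rewrite !opwT //= !mulr1.
have hF := rF (c :: v) _ _ Xc Xc'.
have := @phi_var ((c :: v) ++ u) y y' isT.
rewrite !catr_cat ler_norml => /andP[_ hphi].
have hC : C * th ^+ size (v ++ u) <= C * th ^+ size v.
  by rewrite ler_wpM2l // size_cat ler_wiXn2l ?leq_addr ?(ltW th_lt1).
apply: (@le_trans _ _ (expR (C * th ^+ size v + phi (catr (c :: v) (catr u y')))
   * (expR (B * th ^+ (size v).+1) * F (catr (c :: v) (catr u y'))))).
  apply: ler_pM => //; first exact: F0.
  rewrite ler_expR -lerBlDr; exact: le_trans hC.
rewrite mulrA -expRD [leRHS]mulrA -expRD ler_wpM2r ?F0 // ler_expR.
rewrite le_eqVlt; apply/orP; left; apply/eqP.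
have -> : C = B - B * th by have := distortionE; lra.
by rewrite exprS /=; ring.
Qed.

Lemma nonneg_opw w F : nonneg F -> nonneg (opw w F).
Proof. by move=> F0 y _; apply: opw_ge0. Qed.

Lemma nonneg_Lop n F : nonneg F -> nonneg (Lop n F).
Proof. by move=> F0 y _; apply: Lop_ge0. Qed.

Lemma regular_opw w F : regular F -> nonneg F -> regular (opw w F).
Proof.
elim: w F => [|c w IH] F rF F0.
  by move=> v y y' Xy Xy'; rewrite !opwT // !mul1r; apply: rF.
rewrite -cat1s opw_cat; apply: IH; first exact: regular_opw1.
exact: nonneg_opw.
Qed.

Lemma regular_Lop n F : regular F -> nonneg F -> regular (Lop n F).
Proof.
move=> rF F0 v y y' Xy Xy'; rewrite mulr_sumr.
by apply: ler_sum => w _; apply: regular_opw.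
Qed.

Lemma regular_one : regular one.
Proof.
move=> v y y' _ _; rewrite mulr1 -expR0 ler_expR.
by rewrite mulr_ge0 ?exprn_ge0 // distortion_ge0.
Qed.

(** * Contraction of the oscillation of ratios *)

Lemma Lop_sync J H G k y : nonneg H -> nonneg G -> 0 <= k ->
  (forall v, size v = J -> X (catr v (catr u y)) -> X (catr v (catr u y0)) ->
    H (catr v (catr u y0)) - k * G (catr v (catr u y0)) <= H (catr v (catr u y))) ->
  X (catr u y) ->
  (expR B)^-1 * Lop J H (catr u y0) - expR B * k * Lop J G (catr u y0)
    <= Lop J H (catr u y).
Proof.
move=> H0 G0 k0 Hk Xy; rewrite /Lop !mulr_sumr -sumrB; apply: ler_sum => v _.
have [Xv|Xv] := pselect (X (catr v (catr u y))); last first.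
  have Xv0 : ~ X (catr v (catr u y0)) by move=> /(X_sync X_u Xy).
  by rewrite !opwF // !mulr0 subrr.
have Xv0 := X_sync Xy X_u Xv.
rewrite !opwT //; have := Hk v (size_tuple v) Xv Xv0.
have := wt_distortion v (catr u y0) (catr u y).
have := wt_distortion v (catr u y) (catr u y0).
have := wt_gt0 v (catr u y).
have := H0 _ Xv0; have := G0 _ Xv0.
move: (H _) (H _) (G _) (wt _ _) (wt _ _) => h' h g b a g0 h0 a0 ab ba hk.
have e0 := expR_gt0 B; set e := expR B in ab ba e0 *.
have h1 : e^-1 * b * h <= a * h by rewrite ler_wpM2r // ler_pdivrMl.
have h2 : a * (k * g) <= e * b * (k * g) by rewrite ler_wpM2r // mulr_ge0.
have h3 : a * (h - k * g) <= a * h' by rewrite ler_wpM2l // (ltW a0).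
apply: le_trans h3; rewrite mulrBr lerB //; first by rewrite mulrA.
by have -> : e * k * (b * g) = e * b * (k * g) by ring.
Qed.

(** The numerator is the least weight of the passage through [u] and a connecting word, times the
    distortion loss and the factor 1/2 of the Doeblin dichotomy. The denominator bounds the iterate
    of [G] at any point by its value at the reference point [catr u y0]. *)
Definition contraction_const : R :=
  expR (- Phi) ^+ (size u + l) * (expR B)^-1 / 2 / (Lam ^+ (size u + l) * D).
Local Notation r := (size u + l)%N.

Lemma Lop_bound_gt0 : 0 < Lam.
Proof.
rewrite mulr_gt0 ?expR_gt0 // ltr0n; apply/card_gt0P.
by exists (y0 0%N).
Qed.

Lemma contraction_const_gt0 : 0 < contraction_const.
Proof.
have D0 := harnack_const_gt0 X_u; have L0 := exprn_gt0 r Lop_bound_gt0.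
apply: divr_gt0; last exact: mulr_gt0.
apply: divr_gt0 => //; apply: mulr_gt0; last by rewrite invr_gt0 expR_gt0.
by rewrite exprn_gt0 ?expR_gt0.
Qed.

(** Lower bounds at the single reference point [catr u y0] spread to all of [X]: every [x] is
    preceded by [u] and a connecting word, and after [u] the value at the reference point can be
    compared. *)
Lemma Lop_gap J H G k d x : nonneg H -> nonneg G ->
  (forall n x y, X x -> X y -> Lop n G y <= D * Lop n G x) -> 0 <= k ->
  (forall y v, size v = J ->
    X (catr v (catr u y)) -> X (catr v (catr u y0)) ->
    H (catr v (catr u y0)) - k * G (catr v (catr u y0)) <= H (catr v (catr u y))) ->
  d / 2 * Lop J G (catr u y0) <= Lop J H (catr u y0) ->
  0 <= d - 2 * expR B ^+ 2 * k -> X x ->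
  contraction_const * (d - 2 * expR B ^+ 2 * k) * Lop (J + r) G x
    <= Lop (J + r) H x.
Proof.
move=> H0 G0 hG k0 hk hd hb Xx; rewrite !(LopD J r).
have D0 := harnack_const_gt0 X_u; have L0 := exprn_gt0 r Lop_bound_gt0.
have g0 : 0 <= Lop J G (catr u y0) by apply: Lop_ge0.
have [w sw Xw] := X_spec X_u Xx.
have hH : expR (- Phi) ^+ r * Lop J H (catr u (catr w x)) <= Lop r (Lop J H) x.
  rewrite -catr_cat -sw -size_cat; apply: Lop_point; first exact: nonneg_Lop.
  by rewrite catr_cat.
have hG' : Lop r (Lop J G) x <= D * Lop J G (catr u y0) * Lam ^+ r.
  by apply: Lop_ub => [y Xy|]; [apply: hG|rewrite mulr_ge0 // ltW].
apply: le_trans hH.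
apply: (@le_trans _ _ (contraction_const * (d - 2 * expR B ^+ 2 * k) *
   (D * Lop J G (catr u y0) * Lam ^+ r))).
  by rewrite ler_wpM2l // mulr_ge0 // ltW // contraction_const_gt0.
have e0 := expR_gt0 B.
(* Taking [(expR B)^-1 / 2] out of the difference leaves [d - 2 * expR B ^+ 2 * k], whence the form
   of the statement. *)
apply: (@le_trans _ _ (expR (- Phi) ^+ r *
  ((expR B)^-1 * (d / 2 * Lop J G (catr u y0)) - expR B * k * Lop J G (catr u y0)))).
  rewrite le_eqVlt; apply/orP; left; apply/eqP; rewrite /contraction_const.
  field; do ?[apply/andP; split]; exact: lt0r_neq0.
rewrite ler_wpM2l ?exprn_ge0 ?expR_ge0 //.
apply: le_trans (Lop_sync H0 G0 k0 (hk _) Xw).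
by rewrite lerB // ler_wpM2l // invr_ge0 ltW.
Qed.

Lemma regular_osc F v y y' : regular F -> nonneg F ->
  X (catr v (catr u y)) -> X (catr v (catr u y')) ->
  `|F (catr v (catr u y)) - F (catr v (catr u y'))|
    <= B * expR B * th ^+ size v * F (catr v (catr u y')).
Proof.
move=> rF F0 Xy Xy'; have := rF _ _ _ Xy Xy'; have := rF _ _ _ Xy' Xy.
have := F0 _ Xy; have := F0 _ Xy'; move: (F _) (F _) => a b b0 a0 ba ab.
have t0 : 0 <= th ^+ size v by rewrite exprn_ge0.
have t1 : th ^+ size v <= 1 by rewrite exprn_ile1 // ltW.
have B0 := distortion_ge0; have q1 : 1 <= expR B by rewrite -expR0 ler_expR.
set e := B * th ^+ size v in ba ab.
have e0 : 0 <= e by rewrite mulr_ge0.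
have eq : expR e <= expR B by rewrite ler_expR ler_piMr.
have h1 : 1 - e <= (expR e)^-1 by rewrite -expRN; apply: expR_ge1Dx.
have ee0 := expR_gt0 e.
have h2 : expR e <= 1 + e * expR B.
  have : expR e * (1 - e) <= 1 by rewrite -(ler_pdivlMl _ _ ee0) mulr1.
  have : e * expR e <= e * expR B by rewrite ler_wpM2l.
  lra.
have -> : B * expR B * th ^+ size v * b = e * expR B * b by rewrite /e; ring.
have ea : expR e * b <= (1 + e * expR B) * b by rewrite ler_wpM2r.
have eb : b * (1 - e) <= a.
  apply: (@le_trans _ _ (b * (expR e)^-1)); first by rewrite ler_wpM2l.
  by rewrite ler_pdivrMr // mulrC.
have ec : e * b <= e * expR B * b by rewrite ler_wpM2r // ler_peMr.
rewrite ler_norml; apply/andP; split; lra.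
Qed.

(** The cap 1/2 keeps [1 - delta], and with it the mixing rate, positive even if [th] is 0. *)
Definition rate_const : R := Num.min contraction_const (1 / 2).
Local Notation delta := rate_const.
Local Notation osc_const := (4 * B * expR B ^+ 3).

Lemma rate_const_gt0 : 0 < delta.
Proof. by rewrite lt_min contraction_const_gt0 divr_gt0. Qed.

Lemma osc_const_ge0 : 0 <= osc_const.
Proof.
apply: mulr_ge0; last by rewrite exprn_ge0 ?expR_ge0.
by apply: mulr_ge0 => //; exact: distortion_ge0.
Qed.

Lemma contraction_step J F G M0 m M :
  regular F -> regular G -> nonneg F -> (forall y, X y -> 0 < G y) ->
  (forall n x y, X x -> X y -> Lop n G y <= D * Lop n G x) ->
  0 <= m -> M <= M0 -> (forall y, X y -> m * G y <= F y <= M * G y) ->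
  exists m' M', [/\ m <= m', M' <= M,
    M' - m' <= (1 - delta) * (M - m) + delta * (osc_const * M0 * th ^+ J) &
    forall x, X x -> m' * Lop (J + r) G x <= Lop (J + r) F x
                     <= M' * Lop (J + r) G x].
Proof.
move=> rF rG F0 G0 hG m0 MM0 hmM.
have nG : nonneg G by move=> y /G0 /ltW.
have mM : m <= M.
  have /andP[h1 h2] := hmM _ X_u.
  by rewrite -(ler_pM2r (G0 _ X_u)) (le_trans h1).
have d0 := rate_const_gt0.
set Q := osc_const * M0 * th ^+ J.
have hbd x : X x -> m * Lop (J + r) G x <= Lop (J + r) F x <= M * Lop (J + r) G x.
  move=> Xx; rewrite -!LopZ; apply/andP; split; apply: le_Lop => y /hmM /andP[] //.
(* A bracket already narrower than the error level is kept. *)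
have [br|br] := ltP (M - m) Q.
  exists m, M; split => //.
  by have := ler_wpM2l (ltW d0) (ltW br); lra.
(* In [F - m G] and [M G - F] the oscillations of [F] and of the multiple of [G] each contribute at
   most half of this, relative to [G]. *)
pose k := 2 * M0 * (B * expR B * th ^+ J).
have kE : 2 * expR B ^+ 2 * k = Q by rewrite /k /Q; ring.
have brk : 0 <= M - m - 2 * expR B ^+ 2 * k by rewrite kE subr_ge0.
have M00 : 0 <= M0 by apply: le_trans m0 _; apply: le_trans MM0.
have eta0 : 0 <= B * expR B * th ^+ J.
  exact: mulr_ge0 (mulr_ge0 distortion_ge0 (expR_ge0 _)) (exprn_ge0 _ th_ge0).
have k0 : 0 <= k by rewrite mulr_ge0 // mulr_ge0.
have dle : delta <= contraction_const by rewrite ge_min lexx.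
have hdq x : X x -> delta * (M - m - Q) * Lop (J + r) G x
    <= contraction_const * (M - m - 2 * expR B ^+ 2 * k) * Lop (J + r) G x.
  by move=> Xx; rewrite kE !ler_wpM2r ?subr_ge0 // Lop_ge0.
have hF1 y : X y -> 0 <= 1 * F y + - m * G y by move=> /hmM; lra.
have hF2 y : X y -> 0 <= (- 1) * F y + M * G y by move=> /hmM; lra.
have osc v y : size v = J -> X (catr v (catr u y)) -> X (catr v (catr u y0)) ->
    let z := catr v (catr u y) in let z0 := catr v (catr u y0) in
    [/\ `|F z - F z0| <= (B * expR B * th ^+ J) * M0 * G z0,
        `|G z - G z0| <= (B * expR B * th ^+ J) * G z0 & 0 <= G z0].
  move=> sv Xv Xv0 /=; rewrite -sv; split; last exact: nG.
  - apply: le_trans (regular_osc rF F0 Xv Xv0) _.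
    rewrite -[leRHS]mulrA; apply: ler_wpM2l; first by rewrite sv.
    have /andP[_ h] := hmM _ Xv0; apply: le_trans h _.
    by rewrite ler_wpM2r // nG.
  - exact: regular_osc.
(* The functions [F - m G] and [M G - F] add up to [(M - m) G], so one of them carries at least half
   at the reference point; the corresponding end of the bracket will move. *)
have half : (M - m) / 2 * Lop J G (catr u y0)
      <= Lop J (fun y => 1 * F y + - m * G y) (catr u y0)
   \/ (M - m) / 2 * Lop J G (catr u y0)
      <= Lop J (fun y => (- 1) * F y + M * G y) (catr u y0).
  rewrite !Lop_lin; move: (Lop J G _) (Lop J F _) => g f.
  have [h|h] := lerP ((M - m) / 2 * g) (1 * f + - m * g); [by left|right; lra].
have gen H : nonneg H -> (M - m) / 2 * Lop J G (catr u y0) <= Lop J H (catr u y0) ->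
  (forall v y, size v = J -> X (catr v (catr u y)) -> X (catr v (catr u y0)) ->
   H (catr v (catr u y0)) - k * G (catr v (catr u y0)) <= H (catr v (catr u y))) ->
  forall x, X x -> delta * (M - m - Q) * Lop (J + r) G x <= Lop (J + r) H x.
  move=> H0 hH hk x Xx; apply: le_trans (hdq x Xx) _.
  by apply: Lop_gap => // y v; apply: hk.
have hk1 v y : size v = J ->
    X (catr v (catr u y)) -> X (catr v (catr u y0)) ->
    1 * F (catr v (catr u y0)) + - m * G (catr v (catr u y0))
      - k * G (catr v (catr u y0))
    <= 1 * F (catr v (catr u y)) + - m * G (catr v (catr u y)).
  move=> sv Xv Xv0; have := osc v y sv Xv Xv0; rewrite /= !ler_norml.
  case=> /andP[i1 i2] /andP[i3 i4] i5.
  have : m * (G (catr v (catr u y)) - G (catr v (catr u y0)))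
     <= M0 * (B * expR B * th ^+ J * G (catr v (catr u y0))).
    apply: (@le_trans _ _ (m * (B * expR B * th ^+ J * G (catr v (catr u y0))))).
      by rewrite ler_wpM2l.
    by apply: ler_wpM2r; [exact: mulr_ge0|exact: le_trans mM MM0].
  rewrite /k; move: i1; move: (B * expR B * th ^+ J) => eta; lra.
have hk2 v y : size v = J ->
    X (catr v (catr u y)) -> X (catr v (catr u y0)) ->
    (- 1) * F (catr v (catr u y0)) + M * G (catr v (catr u y0))
      - k * G (catr v (catr u y0))
    <= (- 1) * F (catr v (catr u y)) + M * G (catr v (catr u y)).
  move=> sv Xv Xv0; have := osc v y sv Xv Xv0; rewrite /= !ler_norml.
  case=> /andP[i1 i2] /andP[i3 i4] i5.
  have M_ge0 : 0 <= M by apply: le_trans mM.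
  have : M * (G (catr v (catr u y0)) - G (catr v (catr u y)))
     <= M0 * (B * expR B * th ^+ J * G (catr v (catr u y0))).
    apply: (@le_trans _ _ (M * (B * expR B * th ^+ J * G (catr v (catr u y0))))).
      by rewrite ler_wpM2l //; lra.
    by apply: ler_wpM2r => //; exact: mulr_ge0.
  rewrite /k; move: i2; move: (B * expR B * th ^+ J) => eta; lra.
case: half => half.
  exists (m + delta * (M - m - Q)), M; split => //.
  - by rewrite lerDl mulr_ge0 ?subr_ge0 // ltW.
  - by rewrite -/Q; lra.
  move=> x Xx; have /andP[_ ->] := hbd _ Xx; rewrite andbT.
  by have := gen _ hF1 half hk1 x Xx; rewrite Lop_lin; lra.
exists m, (M - delta * (M - m - Q)); split => //.
- by rewrite gerBl mulr_ge0 ?subr_ge0 // ltW.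
- by rewrite -/Q; lra.
move=> x Xx; have /andP[-> _] := hbd _ Xx; rewrite andTb.
by have := gen _ hF2 half hk2 x Xx; rewrite Lop_lin; lra.
Qed.

Lemma Lop0 F x : X x -> Lop 0 F x = F x.
Proof.
by move=> Xx; rewrite /Lop (sumt0 (fun w => opw w F x)) opwT ?mul1r.
Qed.

(** The additive error does not accumulate over the rounds: with Q the error level,
    [(1 - delta) Q + delta Q] is again Q. *)
Lemma contraction_iter J F G M0 t :
  regular F -> regular G -> nonneg F -> (forall y, X y -> 0 < G y) ->
  (forall n x y, X x -> X y -> Lop n G y <= D * Lop n G x) ->
  0 <= M0 -> (forall y, X y -> F y <= M0 * G y) ->
  exists m M, [/\ 0 <= m, M <= M0,
    M - m <= M0 * (1 - delta) ^+ t + osc_const * M0 * th ^+ J &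
    forall x, X x -> m * Lop (t * (J + r)) G x <= Lop (t * (J + r)) F x
                     <= M * Lop (t * (J + r)) G x].
Proof.
move=> rF rG F0 G0 hG M00 hM; have nG : nonneg G by move=> y /G0 /ltW.
have d0 := rate_const_gt0.
elim: t => [|t [m [M [m0 MM0 hd hb]]]].
  exists 0, M0; split => //; last first.
    by move=> x Xx; rewrite mul0n !Lop0 // mul0r F0 ?hM.
  rewrite subr0 expr0 mulr1 lerDl.
  exact: mulr_ge0 (mulr_ge0 osc_const_ge0 M00) (exprn_ge0 _ th_ge0).
have [|||||m' [M' [h1 h2 h3 h4]]] :=
    @contraction_step J (Lop (t * (J + r)) F) (Lop (t * (J + r)) G) M0 m M _ _ _ _ _ m0 MM0 hb.
- exact: regular_Lop.
- exact: regular_Lop.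
- exact: nonneg_Lop.
- by move=> y; apply: Lop_gt0.
- by move=> n x y Xx Xy; rewrite -!LopD; apply: hG.
exists m', M'; split.
- exact: le_trans h1.
- exact: le_trans MM0.
- apply: le_trans h3 _; rewrite (exprS (1 - delta)).
  have d1 : 0 <= 1 - delta by rewrite subr_ge0 ge_min; apply/orP; right; lra.
  have := ler_wpM2l d1 hd; lra.
- by move=> x Xx; rewrite mulSnr !(LopD (t * (J + r))); apply: h4.
Qed.

Definition mixing_rate : R := Num.max (1 - delta) th.

Lemma mixing_rate_gt0 : 0 < mixing_rate.
Proof.
rewrite lt_max; apply/orP; left.
by rewrite subr_gt0 gt_min; apply/orP; right; lra.
Qed.

Lemma mixing_rate_lt1 : mixing_rate < 1.
Proof. by rewrite gt_max th_lt1 andbT gtrBl rate_const_gt0. Qed.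

Definition mixing_const : R := 1 + osc_const.

Lemma mixing_const_ge0 : 0 <= mixing_const.
Proof. by rewrite addr_ge0 // osc_const_ge0. Qed.

(* Running t contraction steps with common past of length t gives a bound
   exponential in t after t * (t + r) applications of the operator. *)
Lemma Lop_ratio F G M0 t :
  regular F -> regular G -> nonneg F -> (forall y, X y -> 0 < G y) ->
  (forall k x y, X x -> X y -> Lop k G y <= D * Lop k G x) ->
  0 <= M0 -> (forall y, X y -> F y <= M0 * G y) ->
  exists m M, [/\ 0 <= m, M <= M0, M - m <= M0 * mixing_const * mixing_rate ^+ t &
    forall n x, (t * (t + r) <= n)%N ->
      m * Lop n G x <= Lop n F x <= M * Lop n G x].
Proof.
move=> rF rG F0 G0 hG M00 hM.
have [m [M [m0 MM0 hd hb]]] := @contraction_iter t F G M0 t rF rG F0 G0 hG M00 hM.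
exists m, M; split => //; last first.
  move=> n x tn; rewrite -(subnKC tn) !(LopD (t * (t + r))) -!LopZ.
  by apply/andP; split; apply: le_Lop => y /hb /andP[].
apply: le_trans hd _.
have -> : M0 * mixing_const * mixing_rate ^+ t
    = M0 * mixing_rate ^+ t + osc_const * M0 * mixing_rate ^+ t.
  by rewrite /mixing_const; ring.
have d1 : 0 <= 1 - delta by rewrite subr_ge0 ge_min; apply/orP; right; lra.
have h1 : (1 - delta) ^+ t <= mixing_rate ^+ t.
  by rewrite lerXn2r ?nnegrE ?(ltW mixing_rate_gt0) // le_max lexx.
have h2 : th ^+ t <= mixing_rate ^+ t.
  by rewrite lerXn2r ?nnegrE ?(ltW mixing_rate_gt0) // le_max lexx orbT.
apply: lerD; first by rewrite ler_wpM2l.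
by apply: ler_wpM2l => //; apply: mulr_ge0 => //; exact: osc_const_ge0.
Qed.

(** * Occurrence probabilities of words in finite volume *)

Variable x0 : full_shift A.
Hypothesis X_x0 : X x0.
Local Notation rho := mixing_rate.
Local Notation K := mixing_const.

Lemma nonneg_Lop1 k : nonneg (Lop k one).
Proof. exact: nonneg_Lop. Qed.

Lemma regular_Lop1 k : regular (Lop k one).
Proof. by apply: regular_Lop => //; exact: regular_one. Qed.

(* Weighting a word [w] of length N by [opw w one x0 / Lop N one x0] gives the
   finite-volume measure with boundary condition [x0]; under it [occur1 k n a] is
   the probability of reading [a] between [k] symbols and [n] symbols, and
   [occur2] the joint probability of [a] and [b], [d] symbols apart. *)
Definition occur1 k n a : R :=
  Lop n (opw a (Lop k one)) x0 / Lop (k + size a + n) one x0.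

Definition occur2 k d n a b : R :=
  Lop n (opw b (Lop d (opw a (Lop k one)))) x0
  / Lop (k + size a + d + size b + n) one x0.

Lemma opw_Lop1_le k a y : opw a (Lop k one) y <= Lop (k + size a) one y.
Proof. by rewrite LopD; apply: opw_le_Lop => z; exact: nonneg_Lop1. Qed.

(** One bracket serves all later [n] and all boundary points [x], so it can be inserted under a
    further operator. *)
Lemma occur1_bracket k a t : exists m M,
  [/\ 0 <= m, M <= 1, M - m <= K * rho ^+ t & forall n x, (t * (t + r) <= n)%N ->
    m * Lop (k + size a + n) one x <= Lop n (opw a (Lop k one)) x
      <= M * Lop (k + size a + n) one x].
Proof.
have [|||||||m [M [m0 M1 hd hb]]] := @Lop_ratio (opw a (Lop k one))
    (Lop (k + size a) one) 1 t.
- by apply: regular_opw; [exact: regular_Lop1|exact: nonneg_Lop1].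
- exact: regular_Lop1.
- by apply: nonneg_opw; exact: nonneg_Lop1.
- by move=> y; exact: Lop1_gt0.
- by move=> n x y Xx Xy; rewrite -!LopD; exact: harnack.
- by [].
- by move=> y _; rewrite mul1r; exact: opw_Lop1_le.
exists m, M; split => //; first by rewrite mul1r in hd.
by move=> n x tn; rewrite (LopD (k + size a)); exact: hb.
Qed.

Lemma occur1_ge0 k n a : 0 <= occur1 k n a.
Proof.
rewrite divr_ge0 ?(ltW (Lop1_gt0 _ X_x0)) // Lop_ge0 // => y _.
by apply: opw_ge0; exact: nonneg_Lop1.
Qed.

Lemma occur1_le1 k n a : occur1 k n a <= 1.
Proof.
rewrite ler_pdivrMr ?Lop1_gt0 // mul1r LopD; apply: le_Lop => y _.
exact: opw_Lop1_le.
Qed.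

(** The bracket for [a] after [d] steps is inserted under the branch [b]; the conditional
    probability of [a] given [b] and its unconditional probability then lie in the same short
    interval. *)
Lemma occur2_mixing k d n a b t : (t * (t + r) <= d)%N ->
  `|occur2 k d n a b - occur1 k (d + size b + n) a * occur1 (k + size a + d) n b|
    <= K * rho ^+ t.
Proof.
move=> td; have [m [M [m0 M1 hd hb]]] := occur1_bracket k a t.
apply: le_trans hd.
have pb0 := occur1_ge0 (k + size a + d) n b.
have pb1 := occur1_le1 (k + size a + d) n b.
have /andP[a1 a2] : m <= occur1 k (d + size b + n) a <= M.
  have tn : (t * (t + r) <= d + size b + n)%N by lia.
  by rewrite ler_pdivlMr ?ler_pdivrMr ?Lop1_gt0 //; exact: hb.
have /andP[c1 c2] : m * occur1 (k + size a + d) n b <= occur2 k d n a b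
                    <= M * occur1 (k + size a + d) n b.
  have Z0 : 0 < Lop (k + size a + d + size b + n) one x0 by exact: Lop1_gt0.
  rewrite !mulrA ler_pM2r ?invr_gt0 // ler_pM2r ?invr_gt0 //.
  have opwZ c F : (fun y => c * opw b F y) = opw b (fun y => c * F y).
    apply/funext => y; have [Xw|Xw] := pselect (X (catr b y)).
      by rewrite !opwT //; ring.
    by rewrite !opwF // mulr0.
  rewrite -!LopZ !opwZ.
  by apply/andP; split; apply: le_Lop => y _; apply: le_opw => z _;
    have /andP[] := hb _ z td.
move: (occur1 _ _ b) (occur1 _ _ a) (occur2 _ _ _ _ _) pb0 pb1 a1 a2 c1 c2.
move=> pb pa p pb0 pb1 a1 a2 c1 c2.
have mM : 0 <= M - m by rewrite subr_ge0; exact: le_trans a2.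
have e1 : m * pb <= pa * pb by rewrite ler_wpM2r.
have e2 : pa * pb <= M * pb by rewrite ler_wpM2r.
have e3 : (M - m) * pb <= M - m by rewrite ler_piMr.
by rewrite ler_norml; apply/andP; split; lra.
Qed.

Lemma occur1_cauchy_r k n n' a t : (t * (t + r) <= n)%N -> (t * (t + r) <= n')%N ->
  `|occur1 k n a - occur1 k n' a| <= K * rho ^+ t.
Proof.
move=> tn tn'; have [m [M [m0 M1 hd hb]]] := occur1_bracket k a t.
have h i : (t * (t + r) <= i)%N -> m <= occur1 k i a <= M.
  by move=> ti; rewrite ler_pdivlMr ?ler_pdivrMr ?Lop1_gt0 //; exact: hb.
have /andP[] := h _ tn; have /andP[] := h _ tn'.
by move=> *; rewrite ler_norml; apply/andP; split; lra.
Qed.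

(** A longer past replaces the function 1 by an iterate of it, which after normalization at [x0] is
    the [F] below. By Harnack it lies between [D^-1] and [D], and [k] steps make its iterate almost
    proportional to that of 1. One factor [D] comes from this upper bound, the other from the
    denominator. *)
Lemma occur1_cauchy_l k k' n a t : (t * (t + r) <= k)%N -> (k <= k')%N ->
  `|occur1 k' n a - occur1 k n a| <= D ^+ 2 * K * rho ^+ t.
Proof.
move=> tk kk'; have D0 := harnack_const_gt0 X_x0.
pose s := Lop (k' - k) one x0; have s0 : 0 < s by exact: Lop1_gt0.
pose F y := s^-1 * Lop (k' - k) one y.
have FD y : X y -> D^-1 <= F y <= D.
  move=> Xy; rewrite ler_pdivlMl // ler_pdivrMl // [s / D]mulrC ler_pdivrMl //.
  by rewrite [s * D]mulrC !harnack.
have [|||||||m [M [m0 M1 hd hb]]] := @Lop_ratio F one D t.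
- move=> v y y' Xy Xy'; rewrite /F mulrCA ler_pM2l ?invr_gt0 //.
  exact: regular_Lop1.
- exact: regular_one.
- by move=> y /FD /andP[h _]; apply: le_trans h; rewrite invr_ge0 ltW.
- by [].
- by move=> i x y Xx Xy; exact: harnack.
- exact: ltW.
- by move=> y /FD /andP[_]; rewrite mulr1.
have EF : Lop k' one = (fun y => s * Lop k F y).
  apply/funext => y; rewrite -{1}(subnK kk') (LopD (k' - k)) -LopZ; congr Lop.
  by apply/funext => z; rewrite /F mulrA divff ?mul1r // gt_eqF.
have hk y := hb k y tk.
pose N := Lop n (opw a (Lop k one)) x0; pose Z := Lop (k + size a + n) one x0.
have Z0 : 0 < Z by exact: Lop1_gt0.
have N0 : 0 <= N by apply: Lop_ge0 => y _; apply: opw_ge0; exact: nonneg_Lop1.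
have NZ : N <= Z by rewrite /Z LopD; apply: le_Lop => y _; exact: opw_Lop1_le.
have opwZ c G : opw a (fun y => c * G y) = (fun y => c * opw a G y).
  apply/funext => y; have [Xw|Xw] := pselect (X (catr a y)).
    by rewrite !opwT //; ring.
  by rewrite !opwF // mulr0.
have -> : occur1 k' n a
    = Lop n (opw a (Lop k F)) x0 / Lop (size a + n) (Lop k F) x0.
  rewrite /occur1 -addnA (LopD k') EF opwZ !LopZ.
  by rewrite -mulf_div divff ?mul1r // gt_eqF.
have /andP[n1 n2] : m * N <= Lop n (opw a (Lop k F)) x0 <= M * N.
  rewrite /N -!LopZ -!opwZ.
  by apply/andP; split; apply: le_Lop => y _; apply: le_opw => z _;
    have /andP[] := hk z.
have /andP[z1 z2] : m * Z <= Lop (size a + n) (Lop k F) x0 <= M * Z.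
  rewrite /Z -addnA (LopD k) -!LopZ.
  by apply/andP; split; apply: le_Lop => y _; have /andP[] := hk y.
have z3 : D^-1 * Z <= Lop (size a + n) (Lop k F) x0.
  rewrite -LopD /Z -addnA -LopZ; apply: le_Lop => y /FD /andP[h _].
  by rewrite mulr1.
rewrite /occur1 -/N -/Z.
move: (Lop n _ _) (Lop (size a + n) _ _) n1 n2 z1 z2 z3 => N' Z' n1 n2 z1 z2 z3.
have DZ0 : 0 < D^-1 * Z by rewrite mulr_gt0 ?invr_gt0.
have Z'0 : 0 < Z' by apply: lt_le_trans z3.
have mM : 0 <= M - m.
  by rewrite subr_ge0 -(ler_pM2r Z0); exact: le_trans z2.
pose p := N / Z.
have p0 : 0 <= p by rewrite divr_ge0 // ltW.
have p1 : p <= 1 by rewrite ler_pdivrMr // mul1r.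
have NE : N = p * Z by rewrite /p divfK // gt_eqF.
have -> : N' / Z' - N / Z = (N' - p * Z') / Z'.
  by rewrite mulrBl -[p * Z' / Z']mulrA divff ?mulr1 // gt_eqF.
rewrite normrM normfV (gtr0_norm Z'0) ler_pdivrMr //.
apply: (@le_trans _ _ ((M - m) * Z)).
  have h1 : p * (m * Z) <= p * Z' by rewrite ler_wpM2l.
  have h2 : p * Z' <= p * (M * Z) by rewrite ler_wpM2l.
  have h3 : p * ((M - m) * Z) <= (M - m) * Z.
    by rewrite ler_piMl // mulr_ge0 // ltW.
  rewrite NE in n1 n2; rewrite ler_norml; apply/andP; split; lra.
apply: (@le_trans _ _ (D * K * rho ^+ t * Z)); first by rewrite ler_pM2r.
have -> : D * K * rho ^+ t * Z = D ^+ 2 * K * rho ^+ t * (D^-1 * Z).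
  by field; exact: lt0r_neq0.
rewrite ler_wpM2l // mulr_ge0 ?exprn_ge0 ?(ltW mixing_rate_gt0) //.
by rewrite mulr_ge0 ?exprn_ge0 ?(ltW D0) // mixing_const_ge0.
Qed.

(** Two changes of the past, through [maxn k k'], and one change of the future. *)
Definition cauchy_const : R := (2 * D ^+ 2 + 1) * K.

Lemma occur1_cauchy k k' n n' a t :
  (t * (t + r) <= k)%N -> (t * (t + r) <= k')%N ->
  (t * (t + r) <= n)%N -> (t * (t + r) <= n')%N ->
  `|occur1 k n a - occur1 k' n' a| <= cauchy_const * rho ^+ t.
Proof.
move=> tk tk' tn tn'.
have h1 := occur1_cauchy_l n a tk (leq_maxl k k').
have h2 := occur1_cauchy_l n' a tk' (leq_maxr k k').
have h3 := @occur1_cauchy_r (maxn k k') _ _ a t tn tn'.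
rewrite /cauchy_const; move: h1 h2 h3; rewrite !ler_norml.
by move=> /andP[? ?] /andP[? ?] /andP[? ?]; apply/andP; split; lra.
Qed.

(** * Finite-volume measures as weights on words *)

Lemma Lop_sum (I : finType) n (F : I -> full_shift A -> R) x :
  Lop n (fun y => \sum_i F i y) x = \sum_i Lop n (F i) x.
Proof.
by rewrite /Lop exchange_big; apply: eq_bigr => w _; rewrite opw_sum.
Qed.

Lemma opw_Lop a k G : opw a (Lop k G) = fun x => \sum_(p : k.-tuple A) opw (p ++ a) G x.
Proof.
apply/funext => x; rewrite opw_sum; apply: eq_bigr => p _.
by rewrite opw_cat.
Qed.

Lemma Lop_opw_Lop n a k G x :
  Lop n (opw a (Lop k G)) x
  = \sum_(p : k.-tuple A) \sum_(s : n.-tuple A) opw (p ++ (a ++ s)) G x.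
Proof.
rewrite opw_Lop Lop_sum; apply: eq_bigr => p _; apply: eq_bigr => s _.
by rewrite catA (opw_cat (p ++ a)).
Qed.

(* The last [l] symbols are left free, so that every admissible word has positive
   weight whatever the boundary condition. *)
Definition window w : R := Lop l (opw w one) x0 / Lop (size w + l) one x0.

Lemma window_ge0 w : 0 <= window w.
Proof.
rewrite divr_ge0 ?(ltW (Lop1_gt0 _ X_x0)) // Lop_ge0 // => y _.
exact: opw_ge0.
Qed.

Lemma sum_window n : \sum_(w : n.-tuple A) window w = 1.
Proof.
rewrite (eq_bigr (fun w : n.-tuple A => Lop l (opw w one) x0 / Lop (n + l) one x0)).
  by rewrite -mulr_suml -Lop_sum -(LopD n) divff // gt_eqF // Lop1_gt0.
by move=> w _; rewrite /window size_tuple.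
Qed.

Definition occ a k w : R := (take (size a) (drop k w) == a)%:R.

Lemma sum_occ k a n (H : seq A -> R) :
  \sum_(w : (k + (size a + n)).-tuple A) occ a k w * H w
  = \sum_(p : k.-tuple A) \sum_(s : n.-tuple A) H (p ++ (a ++ s)).
Proof.
rewrite (sumt_cat k (size a + n) (fun w => occ a k w * H w)).
apply: eq_bigr => p _.
rewrite (sumt_cat (size a) n (fun w => occ a k (p ++ w) * H (p ++ w))).
rewrite -(sumt_pick a (fun v => \sum_(s : n.-tuple A) H (p ++ (v ++ s)))).
apply: eq_bigr => v _.
have E (s : n.-tuple A) : occ a k (p ++ v ++ s) = (a == v)%:R.
  rewrite /occ drop_size_cat ?size_tuple // take_size_cat ?size_tuple //.
  by rewrite eq_sym.
case: ifP => av; last first.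
  by rewrite big1 // => s _; rewrite E av mul0r.
by apply: eq_bigr => s _; rewrite E av mul1r.
Qed.

Lemma sum_occ_window k a n :
  \sum_(w : (k + (size a + n)).-tuple A) occ a k w * window w = occur1 k (n + l) a.
Proof.
rewrite sum_occ /occur1 (LopD n).
have -> : Lop l (Lop n (opw a (Lop k one))) x0
   = \sum_(p : k.-tuple A) \sum_(s : n.-tuple A) Lop l (opw (p ++ (a ++ s)) one) x0.
  under eq_bigr do rewrite -Lop_sum.
  rewrite -Lop_sum; congr Lop; apply/funext => y; exact: Lop_opw_Lop.
rewrite mulr_suml; apply: eq_bigr => p _; rewrite mulr_suml.
apply: eq_bigr => s _; rewrite /window !size_cat !size_tuple.
by rewrite !addnA.
Qed.

Lemma sum_occ2_window k a d n :
  \sum_(w : (k + (size a + (d + (size a + n)))).-tuple A)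
     occ a k w * (occ a (k + size a + d) w * window w)
  = occur2 k d (n + l) a a.
Proof.
rewrite (sum_occ k a _ (fun w => occ a (k + size a + d) w * window w)).
rewrite /occur2 (LopD n).
have E (p : k.-tuple A) (s : (d + (size a + n)).-tuple A) :
    occ a (k + size a + d) (p ++ (a ++ s)) = occ a d s.
  by rewrite /occ catA addnC -drop_drop drop_size_cat // size_cat size_tuple.
under eq_bigr do under eq_bigr do rewrite E.
under eq_bigr => p _ do
  rewrite (sum_occ d a n (fun s => window (p ++ (a ++ s)))).
have EL y : Lop n (opw a (Lop d (opw a (Lop k one)))) y
   = \sum_(p : k.-tuple A) \sum_(v : d.-tuple A) \sum_(s : n.-tuple A)
        opw (p ++ (a ++ (v ++ (a ++ s)))) one y.
  rewrite Lop_opw_Lop.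
  rewrite [RHS]exchange_big /=; apply: eq_bigr => v _.
  rewrite [RHS]exchange_big /=; apply: eq_bigr => s _.
  by rewrite -opw_cat opw_Lop.
have -> : Lop l (Lop n (opw a (Lop d (opw a (Lop k one))))) x0
   = \sum_(p : k.-tuple A) \sum_(v : d.-tuple A) \sum_(s : n.-tuple A)
        Lop l (opw (p ++ (a ++ (v ++ (a ++ s)))) one) x0.
  under eq_bigr do under eq_bigr do rewrite -Lop_sum.
  under eq_bigr do rewrite -Lop_sum.
  by rewrite -Lop_sum; congr Lop; apply/funext.
rewrite mulr_suml; apply: eq_bigr => p _; rewrite mulr_suml.
apply: eq_bigr => v _; rewrite mulr_suml; apply: eq_bigr => s _.
by rewrite /window !size_cat !size_tuple !addnA.
Qed.

(** * Invariant measures dominated by the finite-volume ones *)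

(* An invariant probability measure enters only through the masses [mw w] of its
   cylinders. *)
Section WordMeasure.
Variables (mw : seq A -> R) (Cm : R).
Hypotheses (mw_ge0 : forall w, 0 <= mw w) (mw_nil : mw [::] = 1).
Hypothesis mw_rcons : forall w, \sum_(c : A) mw (rcons w c) = mw w.
Hypothesis mw_cons : forall w, \sum_(c : A) mw (c :: w) = mw w.
Hypothesis mw_supp : forall w, (forall x, ~ X (catr w x)) -> mw w = 0.
Hypothesis Cm_ge0 : 0 <= Cm.
Hypothesis mw_dom : forall w x, X (catr w x) ->
  mw w <= Cm * wt w x / Lop (size w) one x0.

Lemma sum_mw_catr n w : \sum_(s : n.-tuple A) mw (w ++ s) = mw w.
Proof.
elim: n w => [|n IH] w; first by rewrite (sumt0 (fun s => mw (w ++ s))) cats0.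
rewrite (sumt_cons n (fun s => mw (w ++ s))) -mw_rcons; apply: eq_bigr => c _.
by rewrite -IH; apply: eq_bigr => s _; rewrite cat_rcons.
Qed.

Lemma sum_mw_catl n w : \sum_(p : n.-tuple A) mw (p ++ w) = mw w.
Proof.
elim: n => [|n IH]; first by rewrite (sumt0 (fun s => mw (s ++ w))).
rewrite (sumt_cons n (fun s => mw (s ++ w))) exchange_big /= -IH.
by apply: eq_bigr => p _; exact: mw_cons.
Qed.

Lemma sum_mw n : \sum_(w : n.-tuple A) mw w = 1.
Proof. by rewrite -mw_nil -(sum_mw_catr n [::]). Qed.

Lemma sum_occ_mw k a n :
  \sum_(w : (k + (size a + n)).-tuple A) occ a k w * mw w = mw a.
Proof.
rewrite sum_occ -(sum_mw_catl k a); apply: eq_bigr => p _.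
by rewrite -(sum_mw_catr n (p ++ a)); apply: eq_bigr => s _; rewrite catA.
Qed.

Definition window_const : R := Cm * link_const * Lam ^+ l.

Lemma window_const_ge0 : 0 <= window_const.
Proof.
apply: mulr_ge0; first by rewrite mulr_ge0 // ltW // link_const_gt0.
by rewrite exprn_ge0 // Lop_bound_ge0.
Qed.

Lemma mw_le_window w : mw w <= window_const * window w.
Proof.
have [[x Xw]|Xw] := pselect (exists x, X (catr w x)); last first.
  rewrite mw_supp; first exact: mulr_ge0 window_const_ge0 (window_ge0 w).
  by move=> x Xwx; apply: Xw; exists x.
apply: le_trans (mw_dom Xw) _.
have L0 := Lop1_gt0 (size w) X_x0; have L1 := Lop1_gt0 (size w + l) X_x0.
have hl : wt w x <= link_const * Lop l (opw w one) x0.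
  by rewrite -opw1E //; apply: opw1_le_link => //; exact: X_catr Xw.
have hL : Lop (size w + l) one x0 <= Lam ^+ l * Lop (size w) one x0.
  rewrite addnC LopD -LopZ; apply: le_Lop => y _; rewrite mulr1.
  exact: Lop1_ub.
have -> : window_const * window w = Cm * (link_const * Lop l (opw w one) x0)
    * (Lam ^+ l / Lop (size w + l) one x0).
  by rewrite /window_const /window; ring.
apply: ler_pM.
- by rewrite mulr_ge0 // ltW // wt_gt0.
- by rewrite invr_ge0 ltW.
- by rewrite ler_wpM2l.
- by rewrite ler_pdivlMr // mulrC ler_pdivrMr.
Qed.

Lemma sum_occ_mw_at N k a : (k + size a <= N)%N ->
  \sum_(w : N.-tuple A) occ a k w * mw w = mw a.
Proof.
move=> kN; have -> : N = (k + (size a + (N - k - size a)))%N by lia.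
exact: sum_occ_mw.
Qed.

Lemma sum_occ_window_at N k a : (k + size a <= N)%N ->
  \sum_(w : N.-tuple A) occ a k w * window w = occur1 k (N - k - size a + l) a.
Proof.
move=> kN; have := sum_occ_window k a (N - k - size a).
by have -> : (k + (size a + (N - k - size a)))%N = N by lia.
Qed.

Lemma sum_occ2_window_at N k k' a : (k + size a <= k')%N -> (k' + size a <= N)%N ->
  \sum_(w : N.-tuple A) occ a k w * (occ a k' w * window w)
  = occur2 k (k' - k - size a) (N - k' - size a + l) a a.
Proof.
move=> kk' kN.
have := sum_occ2_window k a (k' - k - size a) (N - k' - size a).
have -> : (k + (size a + ((k' - k - size a) + (size a + (N - k' - size a)))))%N = N.
  by lia.
by have -> : (k + size a + (k' - k - size a))%N = k' by lia.
Qed.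

Lemma cauchy_const_ge0 : 0 <= cauchy_const.
Proof.
apply: mulr_ge0 mixing_const_ge0; rewrite addr_ge0 // mulr_ge0 // exprn_ge0 //.
exact/ltW/(harnack_const_gt0 X_x0).
Qed.

Lemma mixing_le_cauchy : K <= cauchy_const.
Proof.
rewrite ler_peMl ?mixing_const_ge0 // lerDr mulr_ge0 // exprn_ge0 //.
exact/ltW/(harnack_const_gt0 X_x0).
Qed.

(* Both frequencies are averages over the same well separated positions; under
   the finite-volume measure [window] these are almost uncorrelated, and [mw]
   is dominated by [window]. *)
Lemma frequency_variance T t a g : (t * (t + r) <= g)%N ->
  (T%:R * (mw a - occur1 g g a)) ^+ 2
    <= window_const * (T%:R + T%:R ^+ 2 *
         (cauchy_const * rho ^+ t + (cauchy_const * rho ^+ t) ^+ 2)).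
Proof.
move=> tg; set e := cauchy_const * rho ^+ t.
have e0 : 0 <= e.
  by apply: mulr_ge0 cauchy_const_ge0 _; rewrite exprn_ge0 // ltW // mixing_rate_gt0.
(* Room for T copies of [a], with gaps of length [g] between them and at both ends. *)
pose eta := occur1 g g a; pose h := (g + size a)%N; pose N := (g + T * h)%N.
pose pos i := (g + i * h)%N; pose Y i w := occ a (pos i) w - eta.
pose W w := \sum_(i < T) Y i w.
have eta0 : 0 <= eta := occur1_ge0 g g a.
have eta1 : eta <= 1 := occur1_le1 g g a.
have posN (i : 'I_T) : (pos i + size a + g <= N)%N.
  have : (i.+1 * h <= T * h)%N by rewrite leq_mul2r ltn_ord orbT.
  by rewrite mulSn /pos /N /h; lia.
have pos_lt (i j : 'I_T) : (i < j)%N -> (pos i + size a + g <= pos j)%N.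
  move=> ij; have : (i.+1 * h <= j * h)%N by rewrite leq_mul2r ij orbT.
  by rewrite mulSn /pos /h; lia.
have posg i : (g <= pos i)%N by rewrite leq_addr.
have posN' (i : 'I_T) : (pos i + size a <= N)%N by have := posN i; lia.
pose P1 i := occur1 (pos i) (N - pos i - size a + l) a.
have P1e (i : 'I_T) : `|P1 i - eta| <= e.
  apply: occur1_cauchy => //; first exact: leq_trans (posg i).
  by have := posN i; lia.
have EW : \sum_(w : N.-tuple A) W w * mw w = T%:R * (mw a - eta).
  rewrite /W; under eq_bigr do rewrite mulr_suml.
  rewrite exchange_big /=.
  rewrite (eq_bigr (fun=> mw a - eta)); first by rewrite sumr_const card_ord mulr_natl.
  move=> i _; rewrite /Y; under eq_bigr do rewrite mulrBl.
  by rewrite sumrB sum_occ_mw_at // -mulr_sumr sum_mw mulr1.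
have jensen : (T%:R * (mw a - eta)) ^+ 2 <= \sum_(w : N.-tuple A) W w ^+ 2 * mw w.
  set c := T%:R * (mw a - eta) in EW *.
  have : 0 <= \sum_(w : N.-tuple A) (W w - c) ^+ 2 * mw w.
    by apply: sumr_ge0 => w _; rewrite mulr_ge0 ?sqr_ge0.
  have -> : \sum_(w : N.-tuple A) (W w - c) ^+ 2 * mw w
      = \sum_(w : N.-tuple A) W w ^+ 2 * mw w
        - 2 * c * (\sum_(w : N.-tuple A) W w * mw w)
        + c ^+ 2 * (\sum_(w : N.-tuple A) mw w).
    rewrite !mulr_sumr -sumrB -big_split /=; apply: eq_bigr => w _; ring.
  rewrite EW sum_mw; lra.
apply: le_trans jensen _.
(* The square is nonnegative, so domination permits the change of measure. *)
apply: (@le_trans _ _ (window_const * \sum_(w : N.-tuple A) W w ^+ 2 * window w)).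
  rewrite mulr_sumr; apply: ler_sum => w _.
  by rewrite mulrCA ler_wpM2l ?sqr_ge0 // mw_le_window.
rewrite ler_wpM2l ?window_const_ge0 //.
have EWW w : W w ^+ 2 * window w
    = \sum_(i < T) \sum_(j < T) Y i w * (Y j w * window w).
  rewrite expr2 -mulrA {1}/W mulr_suml; apply: eq_bigr => i _.
  by rewrite /W mulr_suml mulr_sumr.
have -> : \sum_(w : N.-tuple A) W w ^+ 2 * window w
    = \sum_(i < T) \sum_(j < T) \sum_(w : N.-tuple A) Y i w * (Y j w * window w).
  under eq_bigr do rewrite EWW.
  rewrite exchange_big /=.
  by apply: eq_bigr => i _; rewrite exchange_big.
have pair i j : (i < T)%N -> (j < T)%N -> (i < j)%N ->
    \sum_(w : N.-tuple A) Y i w * (Y j w * window w) <= e + e ^+ 2.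
  move=> iT jT ij.
  have hi := P1e (Ordinal iT); have hj := P1e (Ordinal jT).
  have hij := pos_lt (Ordinal iT) (Ordinal jT) ij.
  have hiN := posN (Ordinal iT); have hjN := posN (Ordinal jT).
  rewrite /= in hi hj hij hiN hjN.
  pose d := (pos j - pos i - size a)%N; pose n := (N - pos j - size a + l)%N.
  have -> : \sum_(w : N.-tuple A) Y i w * (Y j w * window w)
      = occur2 (pos i) d n a a - eta * P1 i - eta * P1 j + eta ^+ 2.
    have h2 := sum_occ2_window_at (leq_trans (leq_addr _ _) hij)
      (leq_trans (leq_addr _ _) hjN).
    have hi1 := sum_occ_window_at (leq_trans (leq_addr _ _) hiN).
    have hj1 := sum_occ_window_at (leq_trans (leq_addr _ _) hjN).
    rewrite /d /n -h2 /P1 -hi1 -hj1.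
    rewrite -[eta ^+ 2]mulr1 -(sum_window N) !mulr_sumr -!sumrB -big_split /=.
    by apply: eq_bigr => w _; rewrite /Y; ring.
  have tdn : (t * (t + r) <= d)%N by rewrite /d; lia.
  have := @occur2_mixing (pos i) d n a a t tdn.
  have -> : occur1 (pos i) (d + size a + n) a = P1 i.
    by rewrite /P1; congr occur1; rewrite /d /n; lia.
  have -> : occur1 (pos i + size a + d) n a = P1 j.
    by rewrite /P1; congr occur1; rewrite /d /n; lia.
  have : K * rho ^+ t <= e.
    by rewrite ler_wpM2r ?exprn_ge0 ?(ltW mixing_rate_gt0) // mixing_le_cauchy.
  have : (P1 i - eta) * (P1 j - eta) <= e ^+ 2.
    apply: le_trans (ler_norm _) _; rewrite normrM expr2.
    exact: ler_pM.
  rewrite ler_norml => h1 h2 /andP[_ h3]; lra.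
have term (i j : 'I_T) : \sum_(w : N.-tuple A) Y i w * (Y j w * window w)
    <= (i == j)%:R + (e + e ^+ 2).
  have ee : 0 <= e + e ^+ 2 by rewrite addr_ge0 // exprn_ge0.
  have [->|ij] := eqVneq i j; last first.
    rewrite add0r; have [lt_ij|lt_ji] := ltnP i j; first exact: pair.
    rewrite (eq_bigr (fun w : N.-tuple A => Y j w * (Y i w * window w))).
      by apply: pair => //; rewrite ltn_neqAle eq_sym ij.
    by move=> w _; rewrite mulrCA.
  apply: (@le_trans _ _ 1); last by rewrite lerDl.
  rewrite -(sum_window N); apply: ler_sum => w _.
  rewrite mulrA ler_piMl ?window_ge0 // /Y /occ.
  case: (_ == a); rewrite ?mulr1n ?mulr0n; nra.
apply: (@le_trans _ _ (\sum_(i < T) \sum_(j < T) ((i == j)%:R + (e + e ^+ 2)))).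
  by apply: ler_sum => i _; apply: ler_sum => j _; exact: term.
rewrite (eq_bigr (fun=> 1 + T%:R * (e + e ^+ 2))).
  rewrite sumr_const card_ord -mulr_natl; lra.
move=> i _; rewrite big_split /= sumr_const card_ord mulr_natl.
congr (_ + _); rewrite (bigD1 i) //= eqxx big1 ?addr0 // => j ji.
by rewrite eq_sym (negbTE ji).
Qed.

Lemma mixing_rate_small c e : 0 <= c -> 0 < e -> exists t, c * rho ^+ t <= e.
Proof.
move=> c0 e0; have rho1 : `|rho| < 1.
  by rewrite gtr0_norm ?mixing_rate_gt0 // mixing_rate_lt1.
have c1 : 0 < c + 1 by lra.
have /cvgrPdist_le/(_ _ (divr_gt0 e0 c1)) := cvg_expr rho1.
case=> t _ /(_ t (leqnn t)) /=; rewrite sub0r normrN ger0_norm; last first.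
  by rewrite exprn_ge0 // ltW // mixing_rate_gt0.
rewrite ler_pdivlMr // => h; exists t; apply: le_trans h.
have : 0 <= rho ^+ t by rewrite exprn_ge0 // ltW // mixing_rate_gt0.
by move: (rho ^+ t) => z; lra.
Qed.

(** After division by the square of T the diagonal terms contribute [window_const / T], which
    vanishes as T grows while [g] stays fixed. *)
Lemma mw_occur1_dist t a g : (t * (t + r) <= g)%N ->
  (mw a - occur1 g g a) ^+ 2 <= window_const *
     (cauchy_const * rho ^+ t + (cauchy_const * rho ^+ t) ^+ 2).
Proof.
move=> tg; set E := cauchy_const * rho ^+ t + _; apply/ler_addgt0Pr => e e0.
have wc0 := window_const_ge0.
have := archi_boundP (divr_ge0 wc0 (ltW e0)).
set T := Num.Def.archi_bound _; rewrite ltr_pdivrMr // => hT.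
have T0 : 0 < T%:R :> R.
  rewrite ltr0n lt0n; apply/eqP => T0; move: hT; rewrite T0 mul0r.
  by rewrite ltNge wc0.
have := @frequency_variance T t a g tg; rewrite -/E exprMn => h; clearbody E.
have T2 : 0 < T%:R ^+ 2 :> R by rewrite exprn_gt0.
rewrite -(ler_pM2l T2); apply: le_trans h _.
have -> : window_const * (T%:R + T%:R ^+ 2 * E)
    = T%:R ^+ 2 * (window_const * E) + window_const * T%:R by ring.
rewrite mulrDr lerD2l.
have -> : T%:R ^+ 2 * e = T%:R * e * T%:R by ring.
by apply: ler_wpM2r; exact: ltW.
Qed.

Lemma occur1_approx a e : 0 < e -> exists N, forall k n,
  (N <= k)%N -> (N <= n)%N -> `|mw a - occur1 k n a| <= e.
Proof.
move=> e0; have wc0 := window_const_ge0.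
(* The first bound gives [E ^+ 2 <= E], the second handles the Cauchy estimate, the third the
   squared distance. *)
pose e' := Num.min 1 (Num.min (e / 2) ((e / 2) ^+ 2 / (2 * window_const + 1))).
have w1 : 0 < 2 * window_const + 1 by move: wc0; lra.
have e2 : 0 < e / 2 by lra.
have e'0 : 0 < e' by rewrite !lt_min ltr01 e2 divr_gt0 ?exprn_gt0.
have [t ht] := mixing_rate_small cauchy_const_ge0 e'0.
exists (t * (t + r))%N => k n tk tn.
have h1 := occur1_cauchy a tk (leqnn (t * (t + r))) tn (leqnn _).
have h2 := @mw_occur1_dist t a _ (leqnn _).
set E := cauchy_const * rho ^+ t in ht h1 h2.
have E0 : 0 <= E.
  by apply: mulr_ge0 cauchy_const_ge0 _; rewrite exprn_ge0 // ltW // mixing_rate_gt0.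
move: ht; rewrite !le_min => /and3P[E1 E2]; rewrite ler_pdivlMr // => E3.
have h3 : (mw a - occur1 (t * (t + r)) (t * (t + r)) a) ^+ 2 <= (e / 2) ^+ 2.
  apply: le_trans h2 _; apply: le_trans E3.
  have EE : E ^+ 2 <= E by rewrite expr2 ler_piMl.
  apply: (@le_trans _ _ (window_const * (2 * E))).
    by rewrite ler_wpM2l //; lra.
  by lra.
have h4 : `|mw a - occur1 (t * (t + r)) (t * (t + r)) a| <= e / 2.
  by rewrite -(ler_pXn2r (ltn0Sn 1)) ?nnegrE ?(ltW e2) // real_normK ?num_real.
move: h1 h4; rewrite !ler_norml => /andP[? ?] /andP[? ?].
by apply/andP; split; lra.
Qed.

Lemma occur1_cvg a i j : occur1 (k + i) (k + j) a @[k --> \oo] --> mw a.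
Proof.
apply/cvgrPdist_le => e e0; have [N hN] := occur1_approx a e0.
by exists N => // k /= Nk; apply: hN; apply: leq_trans Nk (leq_addr _ _).
Qed.

(* A bound independent of the synchronizing word and of the domination constant. *)
Lemma mw_ub a y x1 : X (catr a y) -> X x1 ->
  mw a <= expR B * D ^+ 3 * wt a y / Lop (size a) one x1.
Proof.
move=> Xa X1; have D0 := harnack_const_gt0 X_x0.
apply: (cvg_le_cst (@occur1_cvg a 0 0)) => k; rewrite !addn0.
have L1 := Lop1_gt0 (size a) X1; have g0 := Lop1_gt0 k X_x0.
set g := Lop k one x0 in g0; set La := Lop (size a) one x1 in L1 *.
have Ln0 := Lop1_gt0 k X_x0; rewrite -/g in Ln0.
(* Harnack is used once here and twice in [den], whence the cube of [D]; the powers of [g] cancel in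
   the quotient. *)
have num : Lop k (opw a (Lop k one)) x0 <= expR B * wt a y * (D * g) * g.
  rewrite -[g in X in _ <= X]/(Lop k one x0) -LopZ; apply: le_Lop => z Xz.
  rewrite mulr1; have [Xw|Xw] := pselect (X (catr a z)).
    rewrite opwT //; apply: ler_pM.
    - exact/ltW/wt_gt0.
    - exact: nonneg_Lop1.
    - exact: wt_distortion.
    - exact: harnack.
  rewrite opwF //; apply: mulr_ge0; last exact: mulr_ge0 (ltW D0) (ltW g0).
  exact: mulr_ge0 (expR_ge0 B) (ltW (wt_gt0 a y)).
have den : g / D * (La / D) * g <= Lop (k + size a + k) one x0.
  rewrite (LopD (k + size a)) /g -(LopZ k (g / D * (La / D)) one).
  apply: le_Lop => v Xv; rewrite mulr1 LopD.
  apply: (@le_trans _ _ (Lop (size a) (fun z => g / D * one z) v)).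
    rewrite LopZ; apply: ler_wpM2l; first exact: divr_ge0 (ltW g0) (ltW D0).
    by rewrite ler_pdivrMr // mulrC; exact: harnack.
  apply: le_Lop => z Xz; rewrite mulr1 ler_pdivrMr // mulrC; exact: harnack.
have den0 : 0 < g / D * (La / D) * g.
  exact: mulr_gt0 (mulr_gt0 (divr_gt0 g0 D0) (divr_gt0 L1 D0)) g0.
rewrite /occur1 ler_pdivrMr; last exact: lt_le_trans den.
apply: le_trans num _.
apply: (@le_trans _ _ (expR B * D ^+ 3 * wt a y / La * (g / D * (La / D) * g))).
  rewrite le_eqVlt; apply/orP; left; apply/eqP.
  by field; rewrite !lt0r_neq0.
rewrite ler_wpM2l //; apply: divr_ge0 (ltW L1).
apply: mulr_ge0 (ltW (wt_gt0 _ _)).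
exact: mulr_ge0 (expR_ge0 B) (exprn_ge0 3 (ltW D0)).
Qed.

Lemma mw_gt0 a y : X (catr a y) -> 0 < mw a.
Proof.
move=> Xa; have D0 := harnack_const_gt0 X_x0; have l0 := link_const_gt0.
have w0 := wt_gt0 a y; have Lam0 := exprn_gt0 (size a + l) Lop_bound_gt0.
pose c := wt a y / (D ^+ 2 * link_const * Lam ^+ (size a + l)).
have c0 : 0 < c.
  exact: divr_gt0 w0 (mulr_gt0 (mulr_gt0 (exprn_gt0 2 D0) l0) Lam0).
apply: (lt_le_trans c0).
(* The [l] extra symbols on the right leave room for a word connecting [a] to any point; the
   resulting bound is uniform in [k]. *)
apply: (cvg_ge_cst (@occur1_cvg a 0 l)) => k; rewrite addn0 /occur1 (addnC k l).
have g0 := Lop1_gt0 k X_x0; set g := Lop k one x0 in g0.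
rewrite ler_pdivlMr ?Lop1_gt0 //.
have -> : (k + size a + (l + k) = k + (size a + l) + k)%N by lia.
rewrite (LopD l) (LopD (k + (size a + l))) -LopZ; apply: le_Lop => z Xz.
apply: (@le_trans _ _ (c * (D * g * Lam ^+ (size a + l)))).
  apply: (ler_wpM2l (ltW c0)); rewrite LopD; apply: Lop_ub.
    by move=> v Xv; exact: harnack.
  exact: mulr_ge0 (ltW D0) (ltW g0).
apply: (@le_trans _ _ (g / D * (wt a y / link_const))).
  rewrite le_eqVlt; apply/orP; left; apply/eqP; rewrite /c.
  by field; rewrite !lt0r_neq0.
apply: (@le_trans _ _ (g / D * Lop l (opw a one) z)).
  apply: ler_wpM2l; first exact: divr_ge0 (ltW g0) (ltW D0).
  rewrite ler_pdivrMr // mulrC -opw1E //.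
  by apply: opw1_le_link => //; exact: X_catr Xa.
rewrite -LopZ; apply: le_Lop => v Xv.
have -> : g / D * opw a one v = opw a (fun s => g / D * one s) v.
  have [Xw|Xw] := pselect (X (catr a v)); last by rewrite !opwF // mulr0.
  by rewrite !opwT //; ring.
apply: le_opw => s Xs; rewrite mulr1 ler_pdivrMr // mulrC; exact: harnack.
Qed.

Lemma occur2_sum k d n a b :
  occur2 k d n a b = \sum_(v : d.-tuple A) occur1 k n (a ++ v ++ b).
Proof.
rewrite /occur2 /occur1.
have -> : Lop n (opw b (Lop d (opw a (Lop k one)))) x0
    = \sum_(v : d.-tuple A) Lop n (opw (a ++ v ++ b) (Lop k one)) x0.
  rewrite -Lop_sum; congr Lop; apply/funext => y; rewrite opw_Lop.
  by apply: eq_bigr => v _; rewrite [in RHS]opw_cat.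
rewrite mulr_suml; apply: eq_bigr => v _; congr (_ / Lop _ _ _).
by rewrite !size_cat size_tuple !addnA.
Qed.

Lemma mw_mixing a b d t : (t * (t + r) <= d)%N ->
  `|\sum_(v : d.-tuple A) mw (a ++ v ++ b) - mw a * mw b| <= K * rho ^+ t.
Proof.
move=> td.
have h2 : occur2 k d k a b @[k --> \oo]
    --> \sum_(v : d.-tuple A) mw (a ++ v ++ b).
  under eq_fun do rewrite occur2_sum.
  apply: cvg_big => [|v _]; first exact: add_continuous.
  by have := @occur1_cvg (a ++ v ++ b) 0 0; under eq_fun do rewrite addn0.
have h1 : occur1 k (d + size b + k) a * occur1 (k + size a + d) k b @[k --> \oo]
    --> mw a * mw b.
  apply: cvgM.
    have := @occur1_cvg a 0 (d + size b).
    by under eq_fun => k do rewrite addn0 (addnC k (d + size b)).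
  have := @occur1_cvg b (size a + d) 0.
  by under eq_fun => k do rewrite addn0 addnA.
apply: (cvg_le_cst (cvg_norm (cvgB h2 h1))) => k.
exact: occur2_mixing.
Qed.

End WordMeasure.

End TransferOperator.

(** * Topology of the space of sequences *)

Section RayTopology.
Variable A : finType.
Implicit Types (x y : full_shift A) (X : set (full_shift A)) (w v : seq A).

Lemma eq_mkseqP x y n :
  mkseq x n = mkseq y n <-> forall i, (i < n)%N -> x i = y i.
Proof.
split=> [e i ni|e]; last first.
  by apply/eq_in_map => i; rewrite mem_iota => /e.
by rewrite -(nth_mkseq (x i) x ni) e nth_mkseq.
Qed.

Lemma mkseq_le x y n m : (n <= m)%N -> mkseq x m = mkseq y m -> mkseq x n = mkseq y n.
Proof.
by move=> nm /eq_mkseqP e; apply/eq_mkseqP => i ni; apply: e; exact: leq_trans nm.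
Qed.

Lemma ray_cvg (F : set_system (full_shift A)) x : Filter F ->
  (forall i, F [set y | y i = x i]) -> F --> x.
Proof.
move=> FF Fx; apply/cvg_sup => i U [_ [[V _ <-] Vx] VU].
by apply: filterS VU _; apply: filterS (Fx i) => y /= yx; move: Vx; rewrite /= yx.
Qed.

Lemma nbhs_coord x i : nbhs x [set y | y i = x i].
Proof.
have := @proj_continuous nat (fun=> discrete_topology A) i x.
by move=> /(_ [set x i]); apply; exact: discrete_set1.
Qed.

Lemma nbhs_mkseq x n : nbhs x [set y | mkseq y n = mkseq x n].
Proof.
suff: nbhs x [set y | forall i, (i < n)%N -> y i = x i].
  by apply: filterS => y /= e; apply/eq_mkseqP.
elim: n => [|n IH]; first exact: filterS filterT.
apply: filterS (filterI IH (nbhs_coord x n)) => y /= [yx yn] i.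
by rewrite ltnS leq_eqVlt => /orP[/eqP ->|/yx].
Qed.

Lemma nbhs_rayP x (U : set (full_shift A)) :
  nbhs x U <-> exists n, forall y, mkseq y n = mkseq x n -> U y.
Proof.
split=> [Ux|[n nU]]; last by apply: filterS (nbhs_mkseq x n) => y; exact: nU.
apply: contrapT => /forallNP h.
have hU n : exists y, mkseq y n = mkseq x n /\ ~ U y.
  by have /existsNP[y /not_implyP[? ?]] := h n; exists y.
have [y hy] := choice hU.
have : y n @[n --> \oo] --> x.
  apply: ray_cvg => i; exists i.+1 => // n /= ni.
  by have [/eq_mkseqP e _] := hy n; rewrite e.
by move=> /(_ _ Ux)[n _ /(_ n (leqnn n))]; have [_] := hy n.
Qed.

Lemma closed_ray X x : closed X ->
  (forall n, exists2 y, X y & mkseq y n = mkseq x n) -> X x.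
Proof.
move=> cX h; apply: cX => U /nbhs_rayP[n nU].
by have [y Xy yx] := h n; exists y; split => //; exact: nU.
Qed.

Lemma compact_closed_ray X : compact X -> closed X.
Proof.
apply: compact_closed; apply: hausdorff_product => _; exact: discrete_hausdorff.
Qed.

Lemma open_cylinder w : open (cylinder w : set (full_shift A)).
Proof.
rewrite openE => x /= xw; apply: filterS (nbhs_mkseq x (size w)) => y /= yx.
by rewrite /cylinder /= yx.
Qed.

Definition admissible X w := exists x, X (catr w x).

Lemma admissibleP X w : admissible X w <-> exists2 x, X x & mkseq x (size w) = w.
Proof.
split=> [[x Xx]|[x Xx <-]]; first by exists (catr w x); rewrite ?mkseq_catr0.
by exists (iter (size w) (@T_shift A) x); rewrite catr_mkseq.
Qed.

Lemma admissible_catl X w v : admissible X (w ++ v) -> admissible X w.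
Proof. by move=> [x]; rewrite catr_cat => Xx; exists (catr v x). Qed.

Lemma langP X m w : lang X m w <-> size w = m.+1 /\ admissible X w.
Proof.
split=> [[x Xx <-]|[sw /admissibleP[x Xx xw]]].
  rewrite subword0E size_mkseq; split => //; apply/admissibleP.
  by exists x; rewrite ?size_mkseq.
by exists x => //; rewrite subword0E -sw.
Qed.

Lemma lang_star_admissible X w : lang_star X w -> admissible X w.
Proof. by move=> [m _ /langP[]]. Qed.

Lemma ft_approxP X m x : ft_approx X m x <->
  forall j, admissible X (mkseq (iter j (@T_shift A) x) m.+1).
Proof.
split=> h j; first by have := h j; rewrite subwordE => /langP[].
by rewrite subwordE; apply/langP; rewrite size_mkseq; split => //; exact: h.
Qed.

End RayTopology.

(** * Specification for points instead of words *)

Section ShiftSpaces.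
Variables (A : finType) (X : set (full_shift A)) (l : nat).
Implicit Types (x y : full_shift A) (w v : seq A).
Hypotheses (X_shift : forall c x, X (consr c x) -> X x) (X_closed : closed X).

Lemma X_iter n x : X x -> X (iter n (@T_shift A) x).
Proof.
elim: n => //= n IH /IH Xx; apply: (@X_shift (iter n (@T_shift A) x 0%N)).
by rewrite consr_T.
Qed.

Lemma admissible_catr w v : admissible X (w ++ v) -> admissible X v.
Proof.
move=> [x]; rewrite catr_cat => Xx; exists x.
by rewrite -(iter_T_catr w (catr v x)); exact: X_iter.
Qed.

Lemma X_prefixes x : (forall n, admissible X (mkseq x n)) -> X x.
Proof.
move=> h; apply: closed_ray X_closed _ => n.
by have /admissibleP[y Xy] := h n; rewrite size_mkseq; exists y.
Qed.

Hypothesis X_spec : is_specification_length X l.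

Lemma word_specification w v : (0 < size w)%N -> (0 < size v)%N ->
  admissible X w -> admissible X v ->
  exists2 s, size s = l & admissible X (w ++ s ++ v).
Proof.
move=> w0 v0 Xw Xv.
have [|| c [Xc _ cw cv]] :=
    X_spec (m := (size w).-1) (n := (size v).-1) (u := w) (v := v) _ _ (leqnn l).
- by apply/langP; rewrite prednK.
- by apply/langP; rewrite prednK.
move: cw cv; rewrite !subword0E !prednK // => cw cv.
exists (mkseq (iter (size w) (@T_shift A) c) l); first by rewrite size_mkseq.
apply/admissibleP; exists c => //.
rewrite !size_cat size_mkseq !mkseqD cw -iterD; congr (_ ++ (_ ++ _)).
rewrite -[RHS]cv; congr mkseq; congr iter; move: w0; lia.
Qed.

(* Since the connecting words range over a finite set, the specification of
   longer and longer prefixes of x yields one connecting word for x itself. *)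
Lemma ray_specification v x y : X (catr v y) -> X x ->
  exists2 w, size w = l & X (catr v (catr w x)).
Proof.
move=> Xv Xx.
wlog v0 : v y Xv / (0 < size v)%N => [hw|].
  case: v Xv => [|c v] Xv; last exact: (hw (c :: v)) Xv isT.
  have [||w sw] := hw [:: y 0%N] (T_shift y) => //; first by rewrite /= consr_T.
  by move=> /X_shift Xw; exists w.
have vadm : admissible X v by exists y.
(* Specification concerns nonempty words, so one more letter of [x] is connected and then
   forgotten. *)
have hn n : exists w : l.-tuple A, admissible X (v ++ w ++ mkseq x n).
  have x0 : (0 < size (mkseq x n.+1))%N by rewrite size_mkseq.
  have xadm : admissible X (mkseq x n.+1).
    by apply/admissibleP; exists x; rewrite ?size_mkseq.
  have [w sw Xw] := word_specification v0 x0 vadm xadm.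
  have ws : size w == l by rewrite sw.
  exists (Tuple ws); move: Xw; rewrite -[n.+1]addn1 mkseqD !catA.
  exact: admissible_catl.
apply: contrapT => /forall2NP hw.
have hn' (w : l.-tuple A) : exists n, ~ admissible X (v ++ w ++ mkseq x n).
  have [/(_ (size_tuple w))//|Xw] := hw w.
  apply: contrapT => /forallNP h; apply: Xw; rewrite -catr_cat.
  apply: X_prefixes => n; have /contrapT := h n.
  rewrite catA -mkseq_catr addnC mkseqD; exact: admissible_catl.
have [g hg] := choice hn'.
have [w] := hn (\max_(w : l.-tuple A) g w).
set M := (\max_(w : _) g w)%N; have gM : (g w <= M)%N by exact: leq_bigmax.
rewrite -(subnKC gM) mkseqD !catA => /admissible_catl.
by rewrite -catA; exact: hg.
Qed.

End ShiftSpaces.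

Section Windows.
Variable A : finType.
Implicit Types (x y : full_shift A) (X : set (full_shift A)) (w v : seq A).

Lemma mkseq_iter x j n N : (j + n <= N)%N ->
  mkseq (iter j (@T_shift A) x) n = take n (drop j (mkseq x N)).
Proof.
move=> jn; have -> : N = (j + (n + (N - j - n)))%N by lia.
rewrite mkseqD drop_size_cat ?size_mkseq // mkseqD.
by rewrite take_size_cat ?size_mkseq.
Qed.

Lemma iter_T_catr_ge w x j : (size w <= j)%N ->
  iter j (@T_shift A) (catr w x) = iter (j - size w) (@T_shift A) x.
Proof. by move=> wj; rewrite -{1}(subnK wj) iterD iter_T_catr. Qed.

Lemma mkseq_iter_catr w x y j n : (j + n <= size w)%N ->
  mkseq (iter j (@T_shift A) (catr w x)) n = mkseq (iter j (@T_shift A) (catr w y)) n.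
Proof. by move=> jn; rewrite !(mkseq_iter _ jn) !mkseq_catr0. Qed.

Lemma closedP X : (forall x, (forall n, exists2 y, X y & mkseq y n = mkseq x n) -> X x) ->
  closed X.
Proof.
move=> h x clx; apply: h => n.
by have [y [Xy yx]] := clx _ (nbhs_mkseq x n); exists y.
Qed.

End Windows.

(** * Specification and synchronization on the approximations *)

Section FiniteTypeApproximation.
Variables (A : finType) (X : set (full_shift A)) (l m : nat).
Implicit Types (x y : full_shift A) (w v : seq A).
Hypotheses (X_shift : forall c x, X (consr c x) -> X x) (X_closed : closed X).
Hypothesis X_spec : is_specification_length X l.
Local Notation Xm := (ft_approx X m).

Lemma ft_approx_sup x : X x -> Xm x.
Proof.
move=> Xx; apply/ft_approxP => j; apply/admissibleP.
by exists (iter j (@T_shift A) x); rewrite ?size_mkseq //; exact: X_iter.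
Qed.

Lemma ft_approx_shift c x : Xm (consr c x) -> Xm x.
Proof.
move=> /ft_approxP h; apply/ft_approxP => j.
by have := h j.+1; rewrite iterSr T_consr.
Qed.

Lemma ft_approx_closed : closed Xm.
Proof.
apply: closedP => x h; apply/ft_approxP => j.
have [y /ft_approxP /(_ j) Xy e] := h (j + m.+1)%N.
by rewrite (mkseq_iter x (leqnn _)) -e -mkseq_iter.
Qed.

Lemma admissible_ft_approx w : admissible Xm w -> (size w <= m.+1)%N ->
  admissible X w.
Proof.
move=> [x /ft_approxP /(_ 0%N)] /= Xw wm; move: Xw.
by rewrite -(subnKC wm) mkseq_catr; exact: admissible_catl.
Qed.

(** Only the last m + 1 letters of [v] and the first m + 1 letters of [x] need connecting, and both
    blocks are words of [X]. Every window of length m + 1 then lies in [v], in the connected word or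
    in [x]; hence the same [l] works for all m. *)
Lemma ft_approx_specification v x y : Xm (catr v y) -> Xm x ->
  exists2 w, size w = l & Xm (catr v (catr w x)).
Proof.
move=> Xv Xx.
wlog v0 : v y Xv / (0 < size v)%N => [hw|].
  case: v Xv => [|c v] Xv; last exact: (hw (c :: v)) Xv isT.
  have [||w sw] := hw [:: y 0%N] (T_shift y) => //; first by rewrite /= consr_T.
  by move=> /ft_approx_shift Xw; exists w.
(* For a short [v] the truncated difference is 0 and [v2] is all of [v]. *)
pose k := (size v - m.+1)%N; pose v2 := drop k v.
have sv1 : size (take k v) = k by rewrite size_takel // leq_subr.
have Ev z : catr v z = catr (take k v) (catr v2 z) by rewrite -catr_cat cat_take_drop.
have sv2 : size v2 = (size v - k)%N by rewrite size_drop.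
have v2adm : admissible X v2.
  apply: admissible_ft_approx; last by rewrite sv2 /k; lia.
  exists y; have := Xv; rewrite Ev; elim: (take k v) => //= c s IH.
  by move=> /ft_approx_shift.
have v20 : (0 < size v2)%N by rewrite sv2 /k; lia.
have xadm : admissible X (mkseq x m.+1) by move/ft_approxP: Xx => /(_ 0%N).
have x0 : (0 < size (mkseq x m.+1))%N by rewrite size_mkseq.
have [s ss Xs] := word_specification X_spec v20 x0 v2adm xadm.
exists s => //; apply/ft_approxP => j.
have [jk|kj] := ltnP j k.
  rewrite (@mkseq_iter_catr _ v _ y); last by rewrite /k in jk; lia.
  by move/ft_approxP: Xv.
rewrite Ev iter_T_catr_ge sv1 // -catr_cat.
move: (j - k)%N => i; have [iW|Wi] := leqP i (size (v2 ++ s)).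
  rewrite (@mkseq_iter _ _ _ _ (size (v2 ++ s) + m.+1)); last by rewrite leq_add2r.
  rewrite mkseq_catr -catA.
  have [z Xz] := Xs.
  apply: (@admissible_catl _ _ _ (drop m.+1 (drop i (v2 ++ s ++ mkseq x m.+1)))).
  rewrite cat_take_drop.
  apply: (@admissible_catr _ _ X_shift (take i (v2 ++ s ++ mkseq x m.+1))).
  by rewrite cat_take_drop; exists z.
rewrite iter_T_catr_ge ?(ltnW Wi) //; by move/ft_approxP: Xx.
Qed.

(** A window of m + 1 letters that starts inside [p] ends inside [p ++ u]. *)
Lemma ft_approx_sync u p y y' : (m <= size u)%N -> Xm (catr u y) -> Xm (catr u y') ->
  Xm (catr p (catr u y)) -> Xm (catr p (catr u y')).
Proof.
move=> mu Xy Xy' Xpy; apply/ft_approxP => j.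
have [jp|pj] := ltnP j (size p).
  rewrite -catr_cat (@mkseq_iter_catr _ (p ++ u) _ y).
    by rewrite catr_cat; move/ft_approxP: Xpy.
  by rewrite size_cat; lia.
by rewrite iter_T_catr_ge //; move/ft_approxP: Xy'.
Qed.

End FiniteTypeApproximation.

(** * Sofic shifts and their synchronizing words *)

Section Sofic.
Variables (A B : finType) (X : set (full_shift A)) (Y : set (full_shift B)).
Variables (f : full_shift B -> full_shift A) (n : nat) (L : set (seq B)).
Hypotheses (Y_sft : Y = [set y | forall j, L (subword y j (j + n))])
  (f_cont : {within Y, continuous f})
  (f_T : forall y, Y y -> f (T_shift y) = T_shift (f y)) (f_Y : f @` Y = X).
Implicit Types (y z : full_shift B) (w v : seq A).

Lemma sftP y : Y y <-> forall j, L (mkseq (iter j (@T_shift B) y) n.+1).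
Proof. by rewrite Y_sft; split => h j; have := h j; rewrite subwordE. Qed.

Lemma sft_iter q y : Y y -> Y (iter q (@T_shift B) y).
Proof. by move=> /sftP h; apply/sftP => j; rewrite -iterD. Qed.

Lemma f_iter q y : Y y -> f (iter q (@T_shift B) y) = iter q (@T_shift A) (f y).
Proof. by move=> Yy; elim: q => // q IH; rewrite !iterS f_T ?IH //; exact: sft_iter. Qed.

(** A node of the König tree: among the extensions of [s], no window length decides the first symbol
    of the image. The maximum with [size s] makes [z] extend [s] as well. *)
Definition unresolved (s : seq B) : Prop := forall r, exists y z,
  [/\ Y y, Y z, mkseq y (size s) = s, mkseq y (maxn r (size s)) = mkseq z (maxn r (size s))
    & f y 0%N <> f z 0%N].

(** If every child were resolved by some window length, the largest of these finitely many lengths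
    would resolve [s]. *)
Lemma unresolved_rcons s : unresolved s -> exists c, unresolved (rcons s c).
Proof.
move=> us; apply: contrapT => /forallNP h.
have hr c : exists r, ~ exists y z, [/\ Y y, Y z,
    mkseq y (size s).+1 = rcons s c,
    mkseq y (maxn r (size s).+1) = mkseq z (maxn r (size s).+1) & f y 0%N <> f z 0%N].
  have /existsNP[r hr] := h c; exists r => -[y [z]]; rewrite -(size_rcons s c) => hyz.
  by apply: hr; exists y, z.
have [r hr'] := choice hr.
pose M := (\max_(c : B) r c)%N.
have [y [z [Yy Yz ys yz fyz]]] := us (maxn M (size s).+1).
apply: (hr' (y (size s))); exists y, z; split => //.
  by rewrite mkseqS ys.
apply: mkseq_le yz; have : (r (y (size s)) <= M)%N by exact: leq_bigmax.
by move=> rM; rewrite geq_max; apply/andP; split; lia.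
Qed.

(* By compactness (here König's lemma) the symbol f(y)(0) depends on a bounded
   window of y. *)
Lemma f_window : exists r, forall y z, Y y -> Y z -> mkseq y r = mkseq z r ->
  f y 0%N = f z 0%N.
Proof.
apply: contrapT => /forallNP h.
have u0 : unresolved [::].
  move=> r; have /existsNP[y /existsNP[z /not_implyP[Yy /not_implyP[Yz]]]] := h r.
  by move=> /not_implyP[yz fyz]; exists y, z; split; rewrite ?maxn0.
have hg s : exists c, unresolved s -> unresolved (rcons s c).
  have [us|us] := pselect (unresolved s).
    by have [c uc] := unresolved_rcons us; exists c.
  have [y [z _]] := u0 0%N; by exists (y 0%N).
have [g hg'] := choice hg.
pose ws := fix ws k := if k is k'.+1 then rcons (ws k') (g (ws k')) else [::].
have ws_u k : unresolved (ws k) by elim: k => //= k; exact: hg'.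
pose y : full_shift B := fun k => g (ws k).
have wsE k : mkseq y k = ws k.
  by elim: k => // k IH; rewrite mkseqS IH.
have prefix (k r : nat) : exists y1 z1, [/\ Y y1, Y z1, mkseq y1 k = mkseq y k,
    mkseq z1 k = mkseq y k & f y1 0%N <> f z1 0%N].
  have [y1 [z1]] := ws_u k r; rewrite -wsE size_mkseq => -[Y1 Y2 e1 e2 fne].
  exists y1, z1; split => //; rewrite -e1; apply: esym.
  by apply: mkseq_le e2; exact: leq_maxr.
have Yy : Y y.
  apply/sftP => j; have [y1 [z1 [/sftP/(_ j) L1 _ e1 _ _]]] := prefix (j + n.+1)%N 0%N.
  by rewrite (mkseq_iter y (leqnn _)) -e1 -mkseq_iter.
have /subspace_continuousP/(_ _ Yy) fy := f_cont.
(* Continuity at the infinite branch fixes the first symbol of the image for all points of [Y] near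
   it, among them two whose images differ there. *)
have /nbhs_rayP[N hN] := fy _ (nbhs_coord (f y) 0%N).
have [y1 [z1 [Y1 Z1 e1 e2]]] := prefix N 0%N; apply.
by apply: etrans (hN _ e1 Y1) _; apply: esym; exact: hN _ e2 Z1.
Qed.

Definition lift_prefixes (N : nat) w : {set N.-tuple B} :=
  [set b : N.-tuple B | `[< exists2 y, Y y &
     mkseq y N = b /\ mkseq (f y) (size w) = w >]].

Lemma lift_prefixesP N w (b : N.-tuple B) : b \in lift_prefixes N w <->
  exists2 y, Y y & mkseq y N = b /\ mkseq (f y) (size w) = w.
Proof. by rewrite inE; split => [/asboolP|h]; last exact/asboolP. Qed.

Lemma admissible_sofic w : admissible X w <-> exists2 y, Y y & mkseq (f y) (size w) = w.
Proof.
rewrite admissibleP -f_Y; split=> [[_ [y Yy <-]]|[y Yy e]]; first by exists y.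
by exists (f y) => //; exists y.
Qed.

(* Paths over the cover may be exchanged at a common block of length N. *)
Lemma splice_path N r q y z :
  (forall y z, Y y -> Y z -> mkseq y r = mkseq z r -> f y 0%N = f z 0%N) ->
  (n < N)%N -> (r <= N)%N -> Y y -> Y z ->
  mkseq (iter q (@T_shift B) y) N = mkseq z N ->
  exists2 x, Y x & mkseq (f x) q = mkseq (f y) q /\ iter q (@T_shift A) (f x) = f z.
Proof.
move=> hr nN rN Yy Yz e; pose x := catr (mkseq y q) z.
have ex : mkseq x (q + N) = mkseq y (q + N).
  by rewrite [RHS]mkseqD e -[in LHS](size_mkseq y q) mkseq_catr.
have xq : iter q (@T_shift B) x = z by rewrite -[q in iter q](size_mkseq y q) iter_T_catr.
have Yx : Y x.
  apply/sftP => j; have [jq|qj] := ltnP j q.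
    have jN : (j + n.+1 <= q + N)%N by lia.
    by rewrite (mkseq_iter x jN) ex -mkseq_iter //; move/sftP: Yy.
  by rewrite -(subnK qj) iterD xq; move/sftP: Yz.
exists x => //; split; last by rewrite -f_iter // xq.
apply/eq_mkseqP => i iq.
have coord t : Y t -> f t i = f (iter i (@T_shift B) t) 0%N.
  by move=> Yt; rewrite f_iter // iter_TE addn0.
rewrite !coord //; apply: hr; [exact: sft_iter|exact: sft_iter|].
have iN : (i + r <= q + N)%N by lia.
by rewrite (mkseq_iter x iN) ex -mkseq_iter.
Qed.

Hypotheses (X_closed : closed X).
Hypothesis X_shift : forall c x, X (consr c x) -> X x.

(* The synchronizing word minimizes the number of blocks of the cover that can
   start a lift of it. *)
Lemma sofic_sync : X !=set0 -> exists (u : seq A) (a0 : full_shift A), X (catr u a0) /\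
  forall (p : seq A) (a b : full_shift A), X (catr u a) -> X (catr u b) ->
    X (catr p (catr u a)) -> X (catr p (catr u b)).
Proof.
move=> [x0 Xx0]; have [r hr] := f_window.
pose N := maxn n.+1 r; pose S := lift_prefixes N.
pose P k := `[< exists2 u, admissible X u & #|S u| = k >].
have exP : exists k, P k by exists #|S [::]|; apply/asboolP; exists [::] => //; exists x0.
case: (ex_minnP exP) => k /asboolP[u [y0 Xu] uk] kmin.
exists u, y0; split => // p y y' Xy Xy' Xp.
apply: (X_prefixes X_closed) => i.
set x' := catr p _.
suff : admissible X (mkseq x' (size p + (size u + i))).
  have -> : (size p + (size u + i) = i + (size p + size u))%N by lia.
  by rewrite mkseqD; exact: admissible_catl.
rewrite /x' !mkseq_catr; set v := mkseq y' i.
have Xuv : admissible X (u ++ v).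
  exists (iter i (@T_shift A) y'); by rewrite catr_cat catr_mkseq.
(* Lengthening [u] can only shrink the set of initial blocks, and minimality forbids a strict loss:
   each block that starts a lift of [u] also starts a lift of [u ++ v]. *)
have SE : S (u ++ v) = S u.
  apply/eqP; rewrite eqEcard uk; apply/andP; split; last first.
    by apply: kmin; apply/asboolP; exists (u ++ v).
  apply/fintype.subsetP => b /lift_prefixesP[z Yz [zb zuv]].
  apply/lift_prefixesP; exists z => //; split => //; move: zuv.
  rewrite size_cat mkseqD => /eqP; rewrite eqseq_cat ?size_mkseq //.
  by move=> /andP[/eqP].
have /admissible_sofic[t Yt] : admissible X (p ++ u) by exists y; rewrite catr_cat.
rewrite size_cat mkseqD => /eqP; rewrite eqseq_cat ?size_mkseq // => /andP[/eqP tp /eqP tu].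
(* The block that a lift of [p ++ u] shows after [p] also starts a lift of [u ++ v], so the two
   paths can be spliced there. *)
have : [tuple of mkseq (iter (size p) (@T_shift B) t) N] \in S u.
  apply/lift_prefixesP; exists (iter (size p) (@T_shift B) t); first exact: sft_iter.
  by split => //; rewrite f_iter.
rewrite -SE => /lift_prefixesP[z Yz [/= zN zuv]].
have [||x Yx [xp xz]] := splice_path hr _ _ Yt Yz (esym zN).
- by rewrite leq_maxl.
- by rewrite leq_maxr.
apply/admissible_sofic; exists x => //.
by rewrite size_cat mkseqD xp tp xz zuv.
Qed.

End Sofic.

(** * Cylinder masses of measures *)

Section WordMass.
Variables (R : realType) (A : pfinType).
Implicit Types (mu : probability (borel_shift A) R) (w v : seq A) (x y : full_shift A).

Definition word_mass mu w : R := fine (mu (cylinder w)).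

Lemma measurable_open (U : set (full_shift A)) :
  open U -> measurable (U : set (borel_shift A)).
Proof. by move=> oU; apply: (@sub_sigma_algebra _ setT (@open (full_shift A))). Qed.

Lemma measurable_closed (U : set (full_shift A)) :
  closed U -> measurable (U : set (borel_shift A)).
Proof.
move=> cU; rewrite -(setCK U); apply: measurableC; apply: measurable_open.
exact: closed_openC.
Qed.

Lemma measurable_cylinder w : measurable (cylinder w : set (borel_shift A)).
Proof. by apply: measurable_open; exact: open_cylinder. Qed.

Lemma fin_mass mu (E : set (borel_shift A)) : measurable E -> mu E \is a fin_num.
Proof. exact: fin_num_measure. Qed.

Lemma fine_partition mu (I : finType) (E : set (borel_shift A))
    (F : I -> set (borel_shift A)) : (forall i, measurable (F i)) ->
  (forall x i j, F i x -> F j x -> i = j) -> (forall x, E x <-> exists i, F i x) ->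
  fine (mu E) = \sum_i fine (mu (F i)).
Proof.
move=> mF dF EF; rewrite sum_fine; last by move=> i _; exact: fin_mass.
congr fine; rewrite fsbig_seq ?index_enum_uniq //.
rewrite -measure_fin_bigcup //; last by move=> i j _ _ [x [Fi Fj]]; exact: dF Fi Fj.
congr (mu _); apply/seteqP; split=> [x /EF[i Fx]|x [i _ Fx]].
  by exists i => //=; rewrite mem_index_enum.
by apply/EF; exists i.
Qed.

Lemma word_mass_ge0 mu w : 0 <= word_mass mu w.
Proof. by rewrite fine_ge0 // measure_ge0. Qed.

Lemma word_mass_nil mu : word_mass mu [::] = 1.
Proof.
rewrite /word_mass (_ : cylinder [::] = setT) ?probability_setT //.
by apply/seteqP; split.
Qed.

Lemma cylinder_rconsP w c x : cylinder (rcons w c) x <-> cylinder w x /\ x (size w) = c.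
Proof.
rewrite /cylinder /= size_rcons mkseqS.
by split=> [/rcons_inj[e1 e2]|[e1 e2]]; [split|rewrite e1 e2].
Qed.

Lemma word_mass_rcons mu w : \sum_(c : A) word_mass mu (rcons w c) = word_mass mu w.
Proof.
symmetry; apply: fine_partition => [c|x c d|x]; first exact: measurable_cylinder.
  by move=> /cylinder_rconsP[_ <-] /cylinder_rconsP[_ <-].
split=> [xw|[c /cylinder_rconsP[]]//]; exists (x (size w)).
exact/cylinder_rconsP.
Qed.

Lemma cylinder_consP w c x : cylinder (c :: w) x <-> x 0%N = c /\ cylinder w (T_shift x).
Proof.
have -> : cylinder (c :: w) x = (x 0%N :: mkseq (T_shift x) (size w) = c :: w).
  by rewrite -mkseq_cons.
by split=> [[-> e]|[-> e]]; [split|congr (_ :: _)].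
Qed.

Lemma word_mass_cons mu (Y : set (full_shift A)) w : invariant_on Y mu ->
  \sum_(c : A) word_mass mu (c :: w) = word_mass mu w.
Proof.
move=> [_ inv]; rewrite /word_mass -inv; last exact: measurable_cylinder.
symmetry; apply: fine_partition => [c|x c d|x]; first exact: measurable_cylinder.
  by move=> /cylinder_consP[<- _] /cylinder_consP[<- _].
split=> [xw|[c /cylinder_consP[]]//]; exists (x 0%N).
exact/cylinder_consP.
Qed.

Lemma word_mass_supp mu (Y : set (full_shift A)) w : closed Y -> mu Y = 1%E ->
  (forall x, ~ Y (catr w x)) -> word_mass mu w = 0.
Proof.
move=> cY muY Yw; have mY := measurable_closed cY.
suff : mu (cylinder w) = 0%E by rewrite /word_mass => ->.
apply/eqP; rewrite -measure_le0 -[leRHS](_ : mu (~` Y) = _).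
  apply: le_measure; rewrite ?inE.
  - exact: measurable_cylinder.
  - exact: measurableC.
  - by move=> x /cylinderP[y ->]; exact: Yw.
by rewrite probability_setC // muY subee.
Qed.

Lemma word_mass_inter mu a b s : (size a <= s)%N ->
  fine (mu (cylinder a `&` iter s (@T_shift A) @^-1` cylinder b))
  = \sum_(v : (s - size a).-tuple A) word_mass mu (a ++ v ++ b).
Proof.
move=> sa; apply: fine_partition => [v|x v v'|x]; first exact: measurable_cylinder.
  rewrite /cylinder /= !size_cat !size_tuple mkseqD => e1 e2.
  have := etrans (esym e1) e2 => /eqP; rewrite eqseq_cat // eqxx /=.
  rewrite eqseq_cat ?size_tuple // eqxx andbT => /eqP e; exact/val_inj.
rewrite /cylinder /=; split=> [[xa xb]|[v]].
  exists [tuple of mkseq (iter (size a) (@T_shift A) x) (s - size a)].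
  by rewrite /= !size_cat size_mkseq !mkseqD xa -iterD subnK ?xb.
rewrite !size_cat size_tuple !mkseqD => /eqP; rewrite eqseq_cat ?size_mkseq //.
move=> /andP[/eqP -> /eqP]; move/eqP; rewrite eqseq_cat ?size_mkseq ?size_tuple //.
by rewrite -iterD subnK // => /andP[_ /eqP ->].
Qed.

Lemma continuous_indic_cylinder w :
  continuous (fun x : full_shift A => \1_(cylinder w) x : R).
Proof.
move=> x U /= Ux; apply: filterS (nbhs_mkseq x (size w)) => y /= yx.
suff -> : \1_(cylinder w) y = \1_(cylinder w) x :> R by exact: nbhs_singleton.
rewrite !indicE; congr (nat_of_bool _)%:R.
by apply/idP/idP; rewrite !inE /cylinder /= yx.
Qed.

Lemma weak_cvg_word_mass (mu_ : nat -> probability (borel_shift A) R) mu w :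
  weak_cvg mu_ mu -> word_mass (mu_ n) w @[n --> \oo] --> word_mass mu w.
Proof.
move=> /(_ _ (@continuous_indic_cylinder w)).
have ind (nu : probability (borel_shift A) R) :
    (\int[nu]_x (\1_(cylinder w) x)%:E)%E = (word_mass nu w)%:E.
  rewrite integral_indic ?setIT //; last exact: measurable_cylinder.
  by rewrite /word_mass fineK // fin_mass //; exact: measurable_cylinder.
under eq_fun do rewrite ind.
by rewrite ind => /fine_cvgP[_].
Qed.

End WordMass.

(** * Gibbs bounds with the pressure eliminated *)

Section GibbsDomination.
Variables (R : realType) (A : pfinType) (phi : full_shift A -> R).
Implicit Types (w : seq A) (x : full_shift A).

Lemma wt_birkhoff w x : (0 < size w)%N ->
  wt phi w x = expR (birkhoff_sum phi (size w).-1 (catr w x)).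
Proof.
case: w => // c w _; rewrite /birkhoff_sum /=.
elim: w c => [|d w IH] c; first by rewrite big_nat1 /= mulr1.
rewrite big_nat_recl //= expRD IH; congr (_ * expR _).
by apply: eq_bigr => i _; rewrite -iterS iterSr.
Qed.

(** The lower Gibbs bounds, summed over the words of one length that may precede [x0], add up to at
    most 1. This bounds the unknown pressure factor by a multiple of the inverse of the iterate at
    [x0]. *)
Lemma gibbs_dom (Y : set (full_shift A)) (mu : probability (borel_shift A) R) x0 :
  (forall c x, Y (consr c x) -> Y x) -> Y x0 -> is_gibbs phi Y mu ->
  (forall n, 0 < Lop Y phi n (fun=> 1) x0) ->
  exists2 K : R, 0 <= K & forall w x, Y (catr w x) ->
    word_mass mu w <= K * wt phi w x / Lop Y phi (size w) (fun=> 1) x0.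
Proof.
move=> Y_shift Yx0 [_ [c [P [c0 gibbs]]]] Lgt0.
have gibbs' w x : (0 < size w)%N -> Y (catr w x) ->
    c^-1 * (wt phi w x * expR (- (size w)%:R * P)) <= word_mass mu w
      <= c * (wt phi w x * expR (- (size w)%:R * P)).
  move=> w0 Yw; have := gibbs (size w).-1 _ Yw.
  rewrite subword0E prednK // mkseq_catr0 expRD -wt_birkhoff // -mulNr.
  have e0 : 0 < wt phi w x * expR (- (size w)%:R * P).
    by rewrite mulr_gt0 ?wt_gt0 ?expR_gt0.
  by rewrite -/(word_mass mu w) ler_pdivlMr // ler_pdivrMr.
(* One [c] from each Gibbs inequality; the summand 1 serves the empty word, on which the Gibbs
   property is silent. *)
exists (c ^+ 2 + 1); first by rewrite addr_ge0 // exprn_ge0 // ltW.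
move=> w x Yw; have [w0|w0] := posnP (size w).
  rewrite (size0nil w0) word_mass_nil /= Lop0 // divr1 mulr1 lerDr.
  by rewrite exprn_ge0 // ltW.
have /andP[_] := gibbs' w x w0 Yw; set e := expR _ => hw.
have e0 : 0 < e by exact: expR_gt0.
have c1 : 0 < c^-1 by rewrite invr_gt0.
have hL : c^-1 * e * Lop Y phi (size w) (fun=> 1) x0 <= 1.
  rewrite -[leRHS](sum_mw (word_mass_nil mu) (word_mass_rcons mu) (size w)) mulr_sumr.
  apply: ler_sum => v _; have [Yv|Yv] := pselect (Y (catr v x0)).
    have v0 : (0 < size v)%N by rewrite size_tuple.
    have /andP[h _] := gibbs' v x0 v0 Yv.
    rewrite opw1E //; move: h; rewrite size_tuple -/e => h.
    by rewrite -mulrA [e * _]mulrC.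
  by rewrite opwF // mulr0 word_mass_ge0.
have W0 := wt_gt0 phi w x.
rewrite ler_pdivlMr //.
apply: (@le_trans _ _ (c * (wt phi w x * e) * Lop Y phi (size w) (fun=> 1) x0)).
  by rewrite ler_pM2r.
have -> : c * (wt phi w x * e) * Lop Y phi (size w) (fun=> 1) x0
    = c ^+ 2 * wt phi w x * (c^-1 * e * Lop Y phi (size w) (fun=> 1) x0).
  by field; exact: lt0r_neq0.
apply: (@le_trans _ _ (c ^+ 2 * wt phi w x)).
  by rewrite ler_piMr // mulr_ge0 ?exprn_ge0 ?ltW.
by rewrite ler_pM2r // lerDl.
Qed.

Lemma Lop_sub (X Y : set (full_shift A)) n x : X `<=` Y ->
  Lop X phi n (fun=> 1) x <= Lop Y phi n (fun=> 1) x.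
Proof.
move=> XY; apply: ler_sum => w _.
have [Xw|Xw] := pselect (X (catr w x)).
  by rewrite opwT // opwT //; exact: XY.
by rewrite opwF // opw_ge0.
Qed.

Lemma holder_constants : is_holder phi -> exists C th Phi : R,
  [/\ 0 <= C, 0 <= th, th < 1,
     forall w x y, (0 < size w)%N ->
       `|phi (catr w x) - phi (catr w y)| <= C * th ^+ (size w).-1
   & forall x, `|phi x| <= Phi].
Proof.
move=> [th [C [th0 th1 C0 hold]]].
(* The sup bound compares each point with the constant sequence of its first letter. *)
exists C, th, (C + \sum_(c : A) `|phi (fun=> c)|); split => //.
- exact: ltW.
- move=> w x y w0; apply: hold.
  by rewrite !subword0E prednK // !mkseq_catr0.
move=> x; have := hold 0%N x (fun=> x 0%N); rewrite !subword0E expr0 mulr1 => /(_ erefl) hx.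
have hc : `|phi (fun=> x 0%N)| <= \sum_(c : A) `|phi (fun=> c)|.
  by rewrite (bigD1 (x 0%N)) //= lerDl sumr_ge0.
rewrite -[phi x](subrK (phi (fun=> x 0%N))); apply: le_trans (ler_normD _ _) _.
exact: lerD.
Qed.

End GibbsDomination.

(** * The square-root rate *)

Section SquareRootRate.
Variables (R : realType) (rho : R).
Hypotheses (rho_gt0 : 0 < rho) (rho_lt1 : rho < 1).

Lemma powR_le_expn (x : R) n : x <= n%:R -> rho ^+ n <= rho `^ x.
Proof.
move=> xn; rewrite -powR_mulrn ?(ltW rho_gt0) // /powR (gt_eqF rho_gt0).
by rewrite ler_expR ler_wnM2r // ln_le0 // ltW.
Qed.

(* With t close to sqrt s one has t * (t + r) + p <= s, and rho ^ t is
   rho ^ (sqrt s) up to a constant, absorbed by the polynomial s = (sqrt s)^2. *)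
Lemma sqrt_rate (K : R) (r p : nat) : 0 <= K -> exists s0 : nat,
  forall s, (s0 <= s)%N -> exists t, [/\ (p <= s)%N, (t * (t + r) <= s - p)%N
    & K * rho ^+ t <= s%:R * rho `^ Num.sqrt s%:R].
Proof.
(* With q the integer part of the square root, t will be q - (r + p). The additional 1 in [c] covers
   the rounding, since the root is below q + 1. *)
move=> K0; pose c := (r + p + 1)%N; pose M := K / rho ^+ c.
have rc : 0 < rho ^+ c by rewrite exprn_gt0.
have M0 : 0 <= M by rewrite divr_ge0 // ltW.
exists (maxn (c * c) (Num.Def.archi_bound M)) => s; rewrite geq_max => /andP[cs Ms].
pose q := Num.Def.trunc (Num.sqrt (s%:R : R)).
have /andP[q1 q2] := truncn_itv (sqrtr_ge0 (s%:R : R)); rewrite -/q in q1 q2.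
have cq : (c <= q)%N.
  rewrite /q truncn_ge_nat ?sqrtr_ge0 // -(ler_pXn2r (ltn0Sn 1)) ?nnegrE ?sqrtr_ge0 //.
  by rewrite sqr_sqrtr // -natrX ler_nat.
have qs : (q * q <= s)%N.
  have : q%:R ^+ 2 <= Num.sqrt (s%:R : R) ^+ 2.
    by rewrite ler_pXn2r ?nnegrE ?sqrtr_ge0.
  by rewrite sqr_sqrtr // -natrX ler_nat.
exists (q - (r + p))%N; split.
- by move: cs; rewrite /c; nia.
- move: cq qs; rewrite /c => cq qs.
  have -> : (q - (r + p) + r = q - p)%N by lia.
  have : ((q - (r + p)) * (q - p) + p <= q * q)%N by nia.
  lia.
have sM : M <= s%:R.
  apply: le_trans (ltW (archi_boundP M0)) _; by rewrite ler_nat.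
have -> : K * rho ^+ (q - (r + p)) = M * rho ^+ q.+1.
  have -> : q.+1 = (c + (q - (r + p)))%N by move: cq; rewrite /c; lia.
  by rewrite exprD mulrA /M divfK // gt_eqF.
apply: ler_pM => //; first by rewrite exprn_ge0 // ltW.
by apply: powR_le_expn; exact: ltW.
Qed.

End SquareRootRate.

(** * Mixing of the limit measure *)

Theorem theorem3p3 (R : realType) (A : pfinType)
    (phi : full_shift A -> R) (X : set (full_shift A))
    (mu_ : nat -> probability (borel_shift A) R)
    (mu : probability (borel_shift A) R) :
  is_holder phi ->
  is_subshift X -> is_sofic X -> is_specified X ->
  (forall m : nat, (1 <= m)%N -> is_gibbs phi (ft_approx X m) (mu_ m)) ->
  weak_cvg mu_ mu ->
  invariant_on X mu ->
  exists (Q : {poly R}) (theta : R),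
    [/\ size Q = 3%N, 0 < theta, theta < 1 &
      forall a b : seq A, lang_star X a -> lang_star X b ->
      exists s0 : nat, forall s : nat, (s0 <= s)%N ->
        `| fine (mu (cylinder a `&` (iter s (@T_shift A)) @^-1` cylinder b))
           / (fine (mu (cylinder a)) * fine (mu (cylinder b))) - 1 |
        <= Q.[Num.sqrt s%:R] * theta `^ Num.sqrt s%:R].
Proof.
move=> /holder_constants[C [th [Phi [C0 th0 th1 phi_var phi_sup]]]].
move=> [X0 Xcomp XT] sofic [l spec] gibbs wcvg inv.
have X_closed := compact_closed_ray Xcomp.
have X_shift c x : X (consr c x) -> X x.
  by move=> Xc; apply: XT; exists (consr c x).
have X_spec := ray_specification X_shift X_closed spec.
have [x0 Xx0] := X0.
have [B [Y [f [[n [L [_ YL]]] f_cont f_T f_Y]]]] := sofic.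
have [u [y0 [X_u X_sync]]] := sofic_sync YL f_cont f_T f_Y X_closed X0.
pose D := expR (distortion C th) * harnack_const A C th Phi l ^+ 3.
have D0 : 0 <= D.
  rewrite mulr_ge0 ?expR_ge0 // exprn_ge0 // ltW //.
  exact: (harnack_const_gt0 X_shift C0 th0 th1 phi_var phi_sup X_spec Xx0).
have bound m w x : (1 <= m)%N -> X (catr w x) ->
    word_mass (mu_ m) w <= D * wt phi w x / Lop X phi (size w) (fun=> 1) x0.
  move=> m1 Xw.
  pose Xm := ft_approx X m; have XXm : X `<=` Xm by move=> z; exact: ft_approx_sup.
  have Xm_shift := @ft_approx_shift A X m.
  have Xm_spec := @ft_approx_specification A X l m X_shift spec.
  (* Any admissible word of length m synchronizes the approximation. Its length enters the rate
     there, but not the constant of [mw_ub]. *)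
  have Xm_u : Xm (catr (mkseq x0 m) (iter m (@T_shift A) x0)).
    by rewrite catr_mkseq; exact: XXm.
  have m_le : (m <= size (mkseq x0 m))%N by rewrite size_mkseq.
  have Xm_sync p y y' := @ft_approx_sync A X m (mkseq x0 m) p y y'.
  have gm := gibbs _ m1.
  have Lgt0 k : 0 < Lop Xm phi k (fun=> 1) x0.
    by apply: (Lop1_gt0 Xm_shift phi_sup Xm_spec); exact: XXm.
  have [K K0 dom] := gibbs_dom Xm_shift (XXm _ Xx0) gm Lgt0.
  have mass_supp v : (forall x, ~ Xm (catr v x)) -> word_mass (mu_ m) v = 0.
    by apply: word_mass_supp; [exact: ft_approx_closed|case: gm => -[]].
  have ub := mw_ub Xm_shift C0 th0 th1 phi_var phi_sup Xm_spec Xm_u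
    (fun p y y' => @Xm_sync p y y' m_le) (XXm _ Xx0) (word_mass_ge0 (mu_ m))
    (word_mass_nil _) (word_mass_rcons _) (fun v => word_mass_cons v gm.1) mass_supp
    K0 dom (XXm _ Xw) (XXm _ Xx0).
  apply: le_trans ub _.
  apply: ler_wpM2l; first exact: mulr_ge0 D0 (ltW (wt_gt0 _ _ _)).
  (* The larger shift has the larger iterate, and it stands in the denominator. *)
  rewrite lef_pV2 ?posrE //; first exact: Lop_sub.
  exact: (Lop1_gt0 X_shift phi_sup X_spec).
have mass_dom w x : X (catr w x) ->
    word_mass mu w <= D * wt phi w x / Lop X phi (size w) (fun=> 1) x0.
  (* The shifted index skips order 0, for which no Gibbs property is assumed. *)
  move=> Xw; apply: (@cvg_le_cst _ (fun k => word_mass (mu_ k.+1) w)).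
    by have := @weak_cvg_word_mass _ _ _ _ w wcvg; rewrite -cvg_shiftS.
  by move=> k; exact: bound.
have mass_supp v : (forall x, ~ X (catr v x)) -> word_mass mu v = 0.
  by apply: word_mass_supp => //; case: inv.
have mass_cons v := word_mass_cons v inv.
have mass_gt0 w : lang_star X w -> 0 < word_mass mu w.
  move=> /lang_star_admissible[y Xy].
  exact: (mw_gt0 X_shift C0 th0 th1 phi_var phi_sup X_spec X_u X_sync Xx0
    (word_mass_ge0 mu) (word_mass_nil _) (word_mass_rcons _) mass_cons mass_supp
    D0 mass_dom Xy).
pose rho := mixing_rate C th Phi l u.
have rho0 : 0 < rho.
  exact: mixing_rate_gt0.
have rho1 : rho < 1.
  exact: (mixing_rate_lt1 X_shift C0 th0 th1 phi_var phi_sup X_spec X_u).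
exists 'X^2, rho; split => //; first by rewrite size_polyXn.
move=> a b La Lb; have ma := mass_gt0 a La; have mb := mass_gt0 b Lb.
have mab : 0 < word_mass mu a * word_mass mu b by rewrite mulr_gt0.
(* The masses enter only through [K], which the polynomial absorbs for large s; this is why [s0]
   depends on [a] and [b] while ['X^2] and [rho] do not. *)
pose K := mixing_const C th / (word_mass mu a * word_mass mu b).
have K0 : 0 <= K by rewrite divr_ge0 ?(ltW mab) // mixing_const_ge0.
have [s0 hs0] := sqrt_rate rho0 rho1 (size u + l) (size a) K0.
exists s0 => s /hs0[t [sa ts rate]].
rewrite hornerXn sqr_sqrtr // word_mass_inter // -/(word_mass mu a) -/(word_mass mu b).
apply: le_trans rate.
have := mw_mixing X_shift C0 th0 th1 phi_var phi_sup X_spec X_u X_sync Xx0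
    (word_mass_ge0 mu) (word_mass_nil _) (word_mass_rcons _) mass_cons mass_supp
    D0 mass_dom a b ts.
set S := \sum_(v : _) _ => hS.
have -> : S / (word_mass mu a * word_mass mu b) - 1
    = (S - word_mass mu a * word_mass mu b) / (word_mass mu a * word_mass mu b).
  by rewrite mulrBl divff // gt_eqF.
rewrite normrM normfV (gtr0_norm mab) /K mulrAC ler_pM2r ?invr_gt0 //.
Qed.
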